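(* There exists $\epsilon_0>0$ such that for every $0<\epsilon<\epsilon_0$ there exist a time $T$ with $0<T<\epsilon$ and a solution $(u(t),\rho(t))$ on $\mathbb{T}^3\times[0,T]$ of the Boussinesq system $$u_t-\Delta u+u\cdot\nabla u+\nabla\pi=\rho e_3,\qquad \rho_t-\Delta\rho+u\cdot\nabla\rho=0,\qquad \nabla\cdot u=0,$$ such that $$\|u(0)\|_{\dot B^{-1}_{\infty,\infty}}+\|\rho(0)\|_{\dot B^{-1}_{\infty,\infty}}<\epsilon$$ and $$\|\rho(T)\|_{\dot B^{-s}_{\infty,\infty}}>1/\epsilon\qquad\text{for every } s>0.$$
   Context: Here $\mathbb{T}^3=(\mathbb{R}/2\pi\mathbb{Z})^3$, $u$ is the $\mathbb{R}^3$-valued velocity, $\rho$ is a scalar function (density or temperature), $\pi$ is the scalar pressure, and $e_3=(0,0,1)$. A solution means a smooth space-periodic solution. For $s>0$ the homogeneous Besov norm is defined by $\|f\|_{\dot B^{-s}_{\infty,\infty}}=\sup_{t>0}t^{s/2}\|e^{t\Delta}f\|_{L^\infty}$, where $e^{t\Delta}$ is the heat semigroup (applied componentwise to vector fields). *)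

(* Defs.v *)
From HB Require Import structures.
From mathcomp Require Import all_boot all_order all_algebra.
From mathcomp Require Import all_classical all_reals all_analysis.

Set Implicit Arguments.
Unset Strict Implicit.
Unset Printing Implicit Defensive.

Import Order.TTheory GRing.Theory Num.Theory.
Import numFieldNormedType.Exports.

Local Open Scope classical_set_scope.
Local Open Scope ring_scope.

(* Functions on the torus (R/2piZ)^3 are represented by functions on R^3 that
   are 2pi-periodic in each coordinate. *)
Definition periodic (R : realType) (V : Type) (f : 'rV[R]_3 -> V) : Prop :=
  forall (i : 'I_3) (x : 'rV[R]_3), f (x + (2 * pi) *: 'e_i) = f x.

Section DifferentialOperators.
Variables (R : realType) (V : normedModType R).

Definition partial (i : 'I_3) (f : 'rV[R]_3 -> V) : 'rV[R]_3 -> V :=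
  'D_('e_i) f.

Definition laplacian (f : 'rV[R]_3 -> V) (x : 'rV[R]_3) : V :=
  \sum_(i < 3) partial i (partial i f) x.

Definition advection (v : 'rV[R]_3 -> 'rV[R]_3) (f : 'rV[R]_3 -> V)
    (x : 'rV[R]_3) : V :=
  \sum_(i < 3) v x 0 i *: partial i f x.

(* Time derivative relative to the interval [0, T]: the limit is taken along
   s in [0, T] only, so it is one-sided at t = 0 and at t = T. *)
Definition time_quotient (f : R -> 'rV[R]_3 -> V) (t : R) (x : 'rV[R]_3)
    (s : R) : V :=
  (s - t)^-1 *: (f s x - f t x).

Definition time_derivable (T : R) (f : R -> 'rV[R]_3 -> V) (t : R)
    (x : 'rV[R]_3) : Prop :=
  cvg (time_quotient f t x @ within `[0, T] t^').

Definition dt (T : R) (f : R -> 'rV[R]_3 -> V) (t : R) (x : 'rV[R]_3) : V :=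
  lim (time_quotient f t x @ within `[0, T] t^').

(* C^k up to the boundary on [0, T] x R^3: all mixed space-time partial
   derivatives of order at most k exist and are jointly continuous there. *)
Fixpoint Ck (T : R) (k : nat) (f : R -> 'rV[R]_3 -> V) : Prop :=
  {within `[0, T] `*` [set: 'rV[R]_3],
    continuous (fun z : R * 'rV[R]_3 => f z.1 z.2)} /\
  if k is k'.+1 then
    [/\ forall (t : R) (x : 'rV[R]_3), t \in `[0, T] ->
          time_derivable T f t x /\ forall i, derivable (f t) x 'e_i,
        Ck T k' (dt T f) &
        forall i, Ck T k' (fun t => partial i (f t))]
  else True.

Definition smooth_periodic (T : R) (f : R -> 'rV[R]_3 -> V) : Prop :=
  (forall k, Ck T k f) /\ (forall t : R, t \in `[0, T] -> periodic (f t)).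

End DifferentialOperators.

Definition divergence (R : realType) (v : 'rV[R]_3 -> 'rV[R]_3)
    (x : 'rV[R]_3) : R :=
  \sum_(i < 3) partial i (fun y => v y 0 i) x.

Definition gradient (R : realType) (p : 'rV[R]_3 -> R) (x : 'rV[R]_3) :
    'rV[R]_3 :=
  \row_(i < 3) partial i p x.

Definition e3 (R : realType) : 'rV[R]_3 := 'e_ord_max.

Definition boussinesq_equations (R : realType) (T : R)
    (u : R -> 'rV[R]_3 -> 'rV[R]_3) (rho p : R -> 'rV[R]_3 -> R) : Prop :=
  forall (t : R) (x : 'rV[R]_3), t \in `[0, T] ->
    [/\ dt T u t x - laplacian (u t) x + advection (u t) (u t) x
          + gradient (p t) x = rho t x *: e3 R,
        dt T rho t x - laplacian (rho t) x + advection (u t) (rho t) x = 0 &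
        divergence (u t) x = 0].

Definition boussinesq_solution (R : realType) (T : R)
    (u : R -> 'rV[R]_3 -> 'rV[R]_3) (rho : R -> 'rV[R]_3 -> R) : Prop :=
  exists p : R -> 'rV[R]_3 -> R,
    [/\ smooth_periodic T u, smooth_periodic T rho, smooth_periodic T p &
        boussinesq_equations T u rho p].

Section HeatSemigroupAndBesovNorms.
Variable R : realType.

Local Notation leb := (@lebesgue_measure R).
Definition mu3 := (leb \x leb \x leb)%E.

(* The library has no Lebesgue measure on 'rV[R]_3; integration is done on
   (R * R) * R and transported by this identification. *)
Definition vec3 (y : R * R * R) : 'rV[R]_3 :=
  \row_(i < 3) [:: y.1.1; y.1.2; y.2]`_i.

Definition l2norm (n : nat) (v : 'rV[R]_n) : R :=
  Num.sqrt (\sum_(i < n) v 0 i ^+ 2).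

Definition heat_kernel (t : R) (y : 'rV[R]_3) : R :=
  (4 * pi * t) `^ (- (3 / 2)) * expR (- (l2norm y ^+ 2 / (4 * t))).

(* e^(t Delta) on periodic functions: convolution on R^3 with the Gaussian,
   i.e. convolution on the torus with the periodized Gaussian. *)
Definition heat (t : R) (f : 'rV[R]_3 -> R) (x : 'rV[R]_3) : R :=
  \int[mu3]_y (heat_kernel t (vec3 y) * f (x - vec3 y)).

Definition heat_vec (t : R) (v : 'rV[R]_3 -> 'rV[R]_3) (x : 'rV[R]_3) :
    'rV[R]_3 :=
  \row_(i < 3) heat t (fun y => v y 0 i) x.

Definition Linfty (f : 'rV[R]_3 -> R) : \bar R :=
  ('N[mu3]_(+oo)[EFin \o f \o vec3])%E.

(* Homogeneous Besov norm of order -s, with values in [0, +oo]. *)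
Definition besov (s : R) (f : 'rV[R]_3 -> R) : \bar R :=
  ereal_sup [set ((t `^ (s / 2))%:E * Linfty (heat t f))%E
            | t in [set t : R | 0 < t]].

Definition besov_vec (s : R) (v : 'rV[R]_3 -> 'rV[R]_3) : \bar R :=
  ereal_sup [set ((t `^ (s / 2))%:E *
                  Linfty (fun x => l2norm (heat_vec t v x)))%E
            | t in [set t : R | 0 < t]].

End HeatSemigroupAndBesovNorms.

(* Main.v *)
(* The solution is explicit: u = (0, v(t, x_1), t rho(t, x_1, x_2)) with zero
   pressure, where v solves the heat equation on the line and
   rho_t = Delta rho - v d_2 rho. The last velocity component t rho then solves
   its equation with source rho automatically, so everything reduces to a linear
   scalar equation. Take v(0) = a sum_(j < n) N_j cos(N_j x_1) and
   rho(0) = v(0) sin x_2 with N_j = 2^j N; lacunarity bounds both B^-1 norms by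
   4a uniformly in n. In the Duhamel expansion of rho, the first interaction of
   v with rho(0) feeds the mode cos x_2, each N_j contributing about a^2/4
   independently of its size, for a total of order n a^2. Since the transport
   derivative only falls on the frequency one of x_2, all other contributions at
   time T vanish as N -> oo with a, n, T fixed. Testing every B^-s norm at heat
   time 1 yields the lower bound simultaneously for all s. *)

Require Import Defs.
From HB Require Import structures.
From mathcomp Require Import all_boot all_order all_algebra.
From mathcomp Require Import all_classical all_reals all_analysis.
From mathcomp Require Import measurable_realfun.
From mathcomp Require Import ring lra.

Set Implicit Arguments.
Unset Strict Implicit.
Unset Printing Implicit Defensive.

Import Order.TTheory GRing.Theory Num.Theory.
Import numFieldNormedType.Exports.

Local Open Scope classical_set_scope.
Local Open Scope ring_scope.

(** Existence comes from writing the Duhamel series down, not from a general theorem. Products of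
    cosines become sums over signed frequencies, so the m-th term is a finite sum over words of m+1
    letters, and each word has a scalar coefficient solving a linear ODE. A further letter d costs
    at most amplitude / d^2 = a / (2|d|) <= a / (2N), while the number of words is multiplied by 2n;
    this is geometric of ratio 1/4 once n a <= N/4. A ratio of 1/4 leaves 2^-m after the polynomial
    losses caused by derivatives. The class [Ck] asks for iterated time derivatives, one-sided at
    the ends, of a series. Jets handle this: a bound together with quadratic Taylor remainders,
    uniform on [0, T], survives summation, and it yields derivatives and joint continuity at once.
    The amplitudes grow like N, so the first two terms of the series are not small by convergence
    alone. They are treated separately: apart from the resonant words they are damped by exp(-N^2
    T). The parameters are fixed in the order a and T, then n, then N. *)

(** * Functions of class Ck *)

Section CkAlgebra.
Context {R : realType} {V : normedModType R}.
Variable T : R.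
Hypothesis T0 : 0 < T.
Implicit Types f g : R -> 'rV[R]_3 -> V.

(** As 0 < T, points of [0, T] accumulate at [t] from the right if t < T and from the left
    otherwise. Properness makes the limit unique, so that [lim] in [dt] can be computed, endpoints
    included. *)
Lemma within_itv_punctured_proper (t : R) :
  t \in `[0, T] -> ProperFilter (within `[0, T] t^').
Proof.
move=> tT; apply: Build_ProperFilter_ex => A [e /= e0 He].
move: tT; rewrite in_itv /= => /andP[t0 tT].
have [tT'|tT'] := ltP t T.
  set d := Num.min (e / 2) (T - t).
  have d0 : 0 < d by rewrite lt_min subr_gt0 tT' divr_gt0.
  exists (t + d); apply: He => /=.
  - rewrite /ball /= opprD addNKr normrN gtr0_norm //.
    by apply: le_lt_trans (_ : e / 2 < e); rewrite ?ge_min ?lexx //; lra.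
  - by rewrite -subr_eq0 addrAC subrr add0r gt_eqF.
  - have dT : d <= T - t by rewrite ge_min lexx orbT.
    by rewrite /= in_itv /=; apply/andP; split; lra.
set d := Num.min (e / 2) t.
have d0 : 0 < d by rewrite lt_min (lt_le_trans T0 tT') divr_gt0.
exists (t - d); apply: He => /=.
- rewrite /ball /= opprB addrCA subrr addr0 gtr0_norm //.
  by apply: le_lt_trans (_ : e / 2 < e); rewrite ?ge_min ?lexx //; lra.
- by rewrite -subr_eq0 addrAC subrr add0r oppr_eq0 gt_eqF.
- have dt : d <= t by rewrite ge_min lexx orbT.
  by rewrite /= in_itv /=; apply/andP; split; lra.
Qed.

Definition is_dt f (t : R) x (l : V) :=
  time_quotient f t x @ within `[0, T] t^' --> l.

Lemma is_dt_dt f t x l : t \in `[0, T] -> is_dt f t x l -> dt T f t x = l.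
Proof.
by move=> /within_itv_punctured_proper ? h; apply: cvg_lim.
Qed.

Lemma is_dt_ext f g t x l : t \in `[0, T] ->
  (forall t x, t \in `[0, T] -> f t x = g t x) ->
  is_dt f t x l -> is_dt g t x l.
Proof.
move=> tT fg; rewrite /is_dt => h; apply: cvg_trans h.
apply: near_eq_cvg; rewrite near_withinE; near=> s => sT.
by rewrite /time_quotient !fg.
Unshelve. all: end_near. Qed.

(** Candidate derivatives are known to agree with [dt] and [partial] only for times in [0, T]. The
    last two hypotheses therefore range over every [g] that agrees with a candidate there. *)
Lemma Ck_step k f f' (df : 'I_3 -> R -> 'rV[R]_3 -> V) :
  {within `[0, T] `*` [set: 'rV[R]_3],
    continuous (fun z : R * 'rV[R]_3 => f z.1 z.2)} ->
  (forall t x, t \in `[0, T] -> is_dt f t x (f' t x)) ->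
  (forall t x i, t \in `[0, T] -> is_derive x 'e_i (f t) (df i t x)) ->
  (forall g, (forall t x, t \in `[0, T] -> g t x = f' t x) -> Ck T k g) ->
  (forall i g, (forall t x, t \in `[0, T] -> g t x = df i t x) -> Ck T k g) ->
  Ck T k.+1 f.
Proof.
move=> fc ft fx f'k dfk /=; split => //; split.
- move=> t x tT; split; first by apply: cvgP; exact: ft.
  by move=> i; have [] := fx t x i tT.
- by apply: f'k => t x tT; apply: is_dt_dt => //; exact: ft.
- move=> i; apply: (dfk i) => t x tT; rewrite /partial.
  by have [_ ->] := fx t x i tT.
Qed.

Lemma within_itv_continuous_ext f g :
  (forall t x, t \in `[0, T] -> f t x = g t x) ->
  {within `[0, T] `*` [set: 'rV[R]_3],
    continuous (fun z : R * 'rV[R]_3 => f z.1 z.2)} ->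
  {within `[0, T] `*` [set: 'rV[R]_3],
    continuous (fun z : R * 'rV[R]_3 => g z.1 z.2)}.
Proof.
move=> fg; apply: subspace_eq_continuous => z /set_mem[zT _] /=.
exact: fg.
Qed.

Lemma Ck_ext k f g : (forall t x, t \in `[0, T] -> f t x = g t x) ->
  Ck T k f -> Ck T k g.
Proof.
elim: k f g => [|k IH] f g fg.
  by move=> [fc _]; split => //; exact: within_itv_continuous_ext fc.
move=> [fc [fd ft fx]].
apply: (@Ck_step _ _ (dt T f) (fun i t => partial i (f t))).
- exact: within_itv_continuous_ext fc.
- move=> t x tT; apply: (is_dt_ext tT fg); exact: (fd t x tT).1.
- move=> t x i tT.
  have -> : g t = f t by apply/funext => y; rewrite fg.
  by apply: DeriveDef => //; exact: (fd t x tT).2.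
- by move=> h hf; apply: IH ft => t x tT; rewrite hf.
- by move=> i h hf; apply: IH (fx i) => t x tT; rewrite hf.
Qed.

Lemma Ck_add k f g : Ck T k f -> Ck T k g -> Ck T k (fun t x => f t x + g t x).
Proof.
elim: k f g => [|k IH] f g.
  move=> [fc _] [gc _]; split => // z.
  by apply: cvgD; [exact: fc | exact: gc].
move=> [fc [fd ft fx]] [gc [gd gt gx]].
apply: (@Ck_step _ _ (fun t x => dt T f t x + dt T g t x)
  (fun i t x => partial i (f t) x + partial i (g t) x)).
- by move=> z; apply: cvgD; [exact: fc | exact: gc].
- move=> t x tT; rewrite /is_dt.
  have -> : time_quotient (fun t0 x0 => f t0 x0 + g t0 x0) t x =
            time_quotient f t x \+ time_quotient g t x.
    by apply/funext => s; rewrite /time_quotient /= -scalerDr opprD addrACA.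
  apply: cvgD; [exact: (fd t x tT).1 | exact: (gd t x tT).1].
- move=> t x i tT; apply: is_deriveD.
    by apply: DeriveDef => //; exact: (fd t x tT).2.
  by apply: DeriveDef => //; exact: (gd t x tT).2.
- move=> h hf; apply: Ck_ext (IH _ _ ft gt) => t x tT; exact/esym/hf.
- move=> i h hf; apply: Ck_ext (IH _ _ (fx i) (gx i)) => t x tT; exact/esym/hf.
Qed.

End CkAlgebra.

Lemma Ck_scalel {R : realType} {V : normedModType R} (T : R) k
    (f : R -> 'rV[R]_3 -> R) (v : V) : 0 < T ->
  Ck T k f -> Ck T k (fun t x => f t x *: v).
Proof.
move=> T0; elim: k f => [|k IH] f.
  by move=> [fc _]; split => // z; apply: cvgZl; exact: fc.
move=> [fc [fd ft fx]].
apply: (@Ck_step _ _ _ T0 _ _ (fun t x => dt T f t x *: v)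
  (fun i t x => partial i (f t) x *: v)).
- by move=> z; apply: cvgZl; exact: fc.
- move=> t x tT; rewrite /is_dt.
  have -> : time_quotient (fun t0 x0 => f t0 x0 *: v) t x =
            (fun s => time_quotient f t x s *: v).
    by apply/funext => s; rewrite /time_quotient /= -scalerBl scalerA.
  apply: cvgZl; exact: (fd t x tT).1.
- move=> t x i tT.
  have h' : (fun h : R => h^-1 *: (((fun x => f t x *: v) \o shift x) (h *: 'e_i) - f t x *: v)) @ 0^' --> (partial i (f t) x *: v).
    rewrite (_ : (fun h : R => _) =
      (fun h : R => (h^-1 *: ((f t \o shift x) (h *: 'e_i) - f t x)) *: v)).
      apply: cvgZl; exact: (fd t x tT).2.
    by apply/funext => s; rewrite /= -scalerBl !scalerA.
  apply: DeriveDef; first by apply: cvgP; exact: h'.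
  exact: cvg_lim h'.
- move=> h hf; apply: (Ck_ext T0) (IH _ ft) => t x tT; exact/esym/hf.
- move=> i h hf; apply: (Ck_ext T0) (IH _ (fx i)) => t x tT; exact/esym/hf.
Qed.

(** * Jets *)

(** The set [D] lets one estimate serve both the time quotient, restricted to [0, T], and the
    spatial quotients, where [D] is the whole line. *)
Lemma cvg_within_linear {R : realType} (D : set R) (q : R -> R) (t l C : R) :
  (forall s, D s -> s != t -> `|q s - l| <= C * `|s - t|) ->
  q @ within D t^' --> l.
Proof.
move=> H; apply/cvgrPdist_le => e e0; rewrite near_withinE.
have C1 : 0 < `|C| + 1 by apply: ltr_pwDr => //.
exists (e / (`|C| + 1)) => /=; first exact: divr_gt0.
move=> s /= st nst sD; rewrite distrC (le_trans (H _ sD nst)) //.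
move: st; rewrite /ball /= distrC ltr_pdivlMr // => /ltW; apply: le_trans.
rewrite mulrC ler_wpM2l //; apply: le_trans (ler_norm C) _; lra.
Qed.

Section Jets.
Context {R : realType}.
Variable T : R.
Hypothesis T0 : 0 < T.
Implicit Types s : nat -> nat -> nat -> R -> R -> R -> R.

(** Differentiability is encoded by Taylor remainders with one constant for all points. Such
    inequalities pass to the limit of a series, and restricting t' to [0, T] matches the one-sided
    derivatives at the two ends. *)
Definition jet_bound (C : R) s r p q := forall t x y, t \in `[0, T] ->
  [/\ `|s r p q t x y| <= C,
      forall t', t' \in `[0, T] ->
       `|s r p q t' x y - s r p q t x y - (t' - t) * s r.+1 p q t x y|
         <= C * (t' - t) ^+ 2,
      forall x', `|s r p q t x' y - s r p q t x y - (x' - x) * s r p.+1 q t x y|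
         <= C * (x' - x) ^+ 2 &
      forall y', `|s r p q t x y' - s r p q t x y - (y' - y) * s r p q.+1 t x y|
         <= C * (y' - y) ^+ 2].

(* [s r p q] plays the role of the derivative of order [r] in [t], [p] in [x]
   and [q] in [y] of [s 0 0 0]. *)
Definition jet s := forall r p q, exists C, jet_bound C s r p q.

Lemma jet0 : jet (fun _ _ _ _ _ _ => 0).
Proof.
move=> r p q; exists 0 => t x y _.
by split => [|? _|?|?]; rewrite ?mulr0 ?subrr ?normr0 ?mul0r.
Qed.

(** Uses h^2 <= (1 + T)|h|. The threshold 1 + T covers the increments below 1 that serve continuity
    as well as time increments inside [0, T]. *)
Lemma taylor_lipschitz (C d h Z Z' : R) :
  `|Z' - Z - h * d| <= C * h ^+ 2 -> `|h| <= 1 + T ->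
  `|Z' - Z| <= (`|d| + `|C| * (1 + T)) * `|h|.
Proof.
move=> H h1; rewrite -[Z' - Z](subrK (h * d)) (le_trans (ler_normD _ _)) //.
rewrite mulrDl addrC normrM [`|h| * _]mulrC lerD2l.
rewrite (le_trans H) // -real_normK ?num_real // expr2 mulrA ler_wpM2r //.
rewrite (le_trans (ler_wpM2r _ (ler_norm C))) // ler_wpM2l //.
Qed.

(** One variable is moved at a time, y, then x, then t. Each move is Lipschitz with a constant
    independent of the other two variables, because the next derivative in that variable is
    bounded. *)
Lemma jet_continuous s r p q : jet s ->
  {within `[0, T] `*` [set: 'rV[R]_3],
    continuous (fun z : R * 'rV[R]_3 => s r p q z.1 (z.2 0 0) (z.2 0 1))}.
Proof.
move=> js; have [C HC] := js r p q.
have [Ct HCt] := js r.+1 p q; have [Cx HCx] := js r p.+1 q.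
have [Cy HCy] := js r p q.+1.
set K := `|Ct| + `|Cx| + `|Cy| + 3 * `|C| * (1 + T).
apply/subspace_continuousP => -[t x] /= [tT _].
have K1 : 0 < K + 1.
  by apply: ltr_pwDr => //; rewrite /K; do ! apply: addr_ge0 => //; rewrite ?mulr_ge0 // addr_ge0 // ltW.
apply/cvgrPdist_le => e e0; rewrite near_withinE.
have d0 : 0 < Num.min 1 (e / (K + 1)) by rewrite lt_min divr_gt0 // ltr01.
exists (ball t (Num.min 1 (e / (K + 1))), ball x (Num.min 1 (e / (K + 1)))) => /=.
  by split; exact: nbhsx_ballx.
move=> [t' x'] /= [tb xb] [t'T _].
have xi i : `|x' 0 i - x 0 i| < Num.min 1 (e / (K + 1)).
  by rewrite distrC; exact: (xb.2 0 i).
have ti : `|t' - t| < Num.min 1 (e / (K + 1)).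
  by rewrite distrC; exact: tb.
set d := Num.min 1 (e / (K + 1)) in d0 xi ti.
have d1 : d <= 1 by rewrite ge_min lexx.
have le1T (h : R) : `|h| < d -> `|h| <= 1 + T.
  by move=> /ltW h1; apply: (le_trans h1); apply: (le_trans d1); rewrite lerDl ltW.
have step (h Z Z' dd D : R) : `|Z' - Z - h * dd| <= C * h ^+ 2 -> `|dd| <= D ->
    `|h| < d -> `|Z' - Z| <= (`|D| + `|C| * (1 + T)) * d.
  move=> H1 H2 H3; apply: (le_trans (taylor_lipschitz H1 (le1T _ H3))).
  apply: ler_pM => //; last exact: ltW.
  - by rewrite addr_ge0 // mulr_ge0 // addr_ge0 // ltW.
  - by rewrite lerD2r (le_trans H2) // ler_norm.
have [_ _ _ Hy] := HC t' (x' 0 0) (x 0 1) t'T.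
have [_ _ Hx _] := HC t' (x 0 0) (x 0 1) t'T.
have [_ Ht _ _] := HC t (x 0 0) (x 0 1) tT.
have By : `|s r p q.+1 t' (x' 0 0) (x 0 1)| <= Cy by have [] := HCy t' (x' 0 0) (x 0 1) t'T.
have Bx : `|s r p.+1 q t' (x 0 0) (x 0 1)| <= Cx by have [] := HCx t' (x 0 0) (x 0 1) t'T.
have Bt : `|s r.+1 p q t (x 0 0) (x 0 1)| <= Ct by have [] := HCt t (x 0 0) (x 0 1) tT.
have {}Hy := step _ _ _ _ _ (Hy (x' 0 1)) By (xi 1).
have {}Hx := step _ _ _ _ _ (Hx (x' 0 0)) Bx (xi 0).
have {}Ht := step _ _ _ _ _ (Ht t' t'T) Bt ti.
rewrite distrC.
set a := s r p q t' (x' 0 0) (x' 0 1) in Hy *.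
set b := s r p q t' (x' 0 0) (x 0 1) in Hy Hx.
set c := s r p q t' (x 0 0) (x 0 1) in Ht Hx.
set o := s r p q t (x 0 0) (x 0 1) in Ht *.
have -> : a - o = (a - b) + (b - c) + (c - o) by ring.
apply: (le_trans (ler_normD _ _)).
apply: (le_trans (lerD (ler_normD _ _) (lexx _))).
apply: (le_trans (lerD (lerD Hy Hx) Ht)).
rewrite -!mulrDl.
have -> : `|Cy| + `|C| * (1 + T) + (`|Cx| + `|C| * (1 + T)) + (`|Ct| + `|C| * (1 + T)) = K by rewrite /K; ring.
have : d <= e / (K + 1) by rewrite ge_min lexx orbT.
rewrite ler_pdivlMr // => H; apply: le_trans H.
by rewrite mulrC ler_wpM2l ?ltW // ltrDl.
Qed.

Lemma quotient_taylor (C h Z Z' d : R) : h != 0 ->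
  `|Z' - Z - h * d| <= C * h ^+ 2 -> `|h^-1 * (Z' - Z) - d| <= C * `|h|.
Proof.
move=> h0 H; rewrite -[X in _ - X](mulKf h0) -mulrBr normrM normfV.
rewrite mulrC ler_pdivrMr ?normr_gt0 // (le_trans H) //.
by rewrite -mulrA -expr2 real_normK ?num_real.
Qed.

Definition jet_dx s r p q (i : 'I_3) t (x : 'rV[R]_3) : R :=
  match val i with
  | 0%N => s r p.+1 q t (x 0 0) (x 0 1)
  | 1%N => s r p q.+1 t (x 0 0) (x 0 1)
  | _ => 0
  end.

Lemma jet_is_dt s r p q t (x : 'rV[R]_3) : jet s -> t \in `[0, T] ->
  is_dt T (fun t x => s r p q t (x 0 0) (x 0 1)) t x
    (s r.+1 p q t (x 0 0) (x 0 1)).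
Proof.
move=> js tT; have [C /(_ t (x 0 0) (x 0 1) tT) [_ HC _ _]] := js r p q.
apply: (@cvg_within_linear _ _ _ _ _ C) => t' t'T tt'.
by apply: quotient_taylor; rewrite ?subr_eq0 //; apply: HC.
Qed.

Lemma jet_is_derive s r p q t (x : 'rV[R]_3) i : jet s -> t \in `[0, T] ->
  is_derive x 'e_i (fun x : 'rV[R]_3 => s r p q t (x 0 0) (x 0 1))
    (jet_dx s r p q i t x).
Proof.
move=> js tT; have [C /(_ t (x 0 0) (x 0 1) tT) [_ _ HCx HCy]] := js r p q.
suff h : (fun h : R => h^-1 *: (((fun x : 'rV[R]_3 =>
    s r p q t (x 0 0) (x 0 1)) \o shift x) (h *: 'e_i)
    - s r p q t (x 0 0) (x 0 1))) @ 0^' --> jet_dx s r p q i t x.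
  by apply: DeriveDef; [apply: cvgP; exact: h | exact: cvg_lim h].
have -> : (0 : R)^' = within setT (0 : R)^' by rewrite withinET.
apply: (@cvg_within_linear _ _ _ _ _ C) => h _ h0 /=.
rewrite subr0.
case: i => -[|[|[|//]]] i3; rewrite /jet_dx /=; set e := 'e__.
- have -> : (h *: e + x) 0 0 = h + x 0 0 by rewrite !mxE /= mulr1.
  have -> : (h *: e + x) 0 1 = x 0 1 by rewrite !mxE /= mulr0 add0r.
  by apply: quotient_taylor => //; have := HCx (h + x 0 0); rewrite addrK.
- have -> : (h *: e + x) 0 0 = x 0 0 by rewrite !mxE /= mulr0 add0r.
  have -> : (h *: e + x) 0 1 = h + x 0 1 by rewrite !mxE /= mulr1.
  by apply: quotient_taylor => //; have := HCy (h + x 0 1); rewrite addrK.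
- have -> : (h *: e + x) 0 0 = x 0 0 by rewrite !mxE /= mulr0 add0r.
  have -> : (h *: e + x) 0 1 = x 0 1 by rewrite !mxE /= mulr0 add0r.
  (* Nothing depends on the third coordinate, so the quotient is 0. The increment 1 in the first
     variable serves only to learn 0 <= C. *)
  rewrite subrr scaler0 subr0 normr0.
  have := HCx (x 0 0 + 1); rewrite (addrC (x 0 0)) addrK expr1n mulr1 => C0.
  by rewrite mulr_ge0 // (le_trans _ C0).
Qed.

(** A derivative of a jet entry is the entry with one index raised, or 0 for the third coordinate,
    so the induction on [k] stays within jets. *)
Lemma Ck_jet s k r p q : jet s ->
  Ck T k (fun t x => s r p q t (x 0 0) (x 0 1)).
Proof.
elim: k s r p q => [|k IH] s r p q js.
  by split => //; exact: jet_continuous.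
apply: (@Ck_step _ _ _ T0 _ _
  (fun t x => s r.+1 p q t (x 0 0) (x 0 1))
  (fun i t x => jet_dx s r p q i t x)).
- exact: jet_continuous.
- by move=> t x tT; exact: jet_is_dt.
- by move=> t x i tT; exact: jet_is_derive.
- by move=> g gE; apply: (Ck_ext T0) (IH _ r.+1 p q js) => t x tT; rewrite gE.
- case=> -[|[|[|//]]] i3 g gE.
  + by apply: (Ck_ext T0) (IH _ r p.+1 q js) => t x tT; rewrite gE.
  + by apply: (Ck_ext T0) (IH _ r p q.+1 js) => t x tT; rewrite gE.
  + by apply: (Ck_ext T0) (IH _ r p q jet0) => t x tT; rewrite gE.
Qed.

End Jets.

(** * Taylor remainders from derivatives, and geometrically dominated series *)

Section Taylor.
Context {R : realType}.
Implicit Types (g : R -> R) (a b : R).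

(** The points may come in either order. The location of [c] is recorded because Taylor's estimate
    applies the theorem a second time, between [a] and [c]. *)
Lemma MVT_between g g' (i : interval R) a b :
  (forall z, z \in i -> is_derive z 1 g (g' z)) -> a \in i -> b \in i ->
  exists2 c, c \in i /\ `|c - a| <= `|b - a| & g b - g a = g' c * (b - a).
Proof.
move=> dg ai bi.
have H u w : u <= w -> u \in i -> w \in i ->
    exists2 c, c \in `[u, w] & g w - g u = g' c * (w - u).
  move=> uw ui wi.
  have sub z : z \in `[u, w] -> z \in i.
    by move=> zuw; apply: (interval_is_interval ui wi); move: zuw; rewrite in_itv.
  apply: (MVT_segment uw).
  - by move=> z zuw; apply/dg/sub; exact: subset_itv_oo_cc.
  - by apply: derivable_within_continuous => z zuw; have [] := dg z (sub z zuw).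
have [ab|/ltW ba] := leP a b.
  have [c] := H a b ab ai bi; rewrite in_itv /= => /andP[ac cb] E.
  exists c => //; split.
    by apply: (interval_is_interval ai bi); rewrite ac.
  by rewrite !ger0_norm ?subr_ge0 // lerD2r.
have [c] := H b a ba bi ai; rewrite in_itv /= => /andP[bc ca] E.
exists c; last by rewrite -opprB E -mulrN opprB.
split; first by apply: (interval_is_interval bi ai); rewrite bc.
by rewrite distrC [`|b - a|]distrC !ger0_norm ?subr_ge0 // lerD2l lerN2.
Qed.

Lemma taylor_bound g g' g'' (i : interval R) (M : R) a b :
  (forall z, z \in i -> is_derive z 1 g (g' z)) ->
  (forall z, z \in i -> is_derive z 1 g' (g'' z)) ->
  (forall z, z \in i -> `|g'' z| <= M) -> a \in i -> b \in i ->
  `|g b - g a - (b - a) * g' a| <= M * (b - a) ^+ 2.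
Proof.
move=> dg dg' M2 ai bi.
have [c [ci ca] ->] := MVT_between dg ai bi.
have [e [ei _] E] := MVT_between dg' ai ci.
rewrite mulrC -mulrBr E !normrM mulrCA -real_normK ?num_real //.
rewrite ler_pM // ?mulr_ge0 //; first exact: M2.
by rewrite expr2 ler_wpM2l.
Qed.

Lemma half_geometric_cvg : series (fun m => 2^-1 ^+ m : R) @ \oo --> (2 : R).
Proof.
have h1 : `|2^-1 : R| < 1 by rewrite ger0_norm ?invr_ge0 // invf_lt1 // ltr1n.
have := @cvg_geometric_series R 1 2^-1 h1.
by rewrite -exprn_geometric (_ : 1 * (1 - 2^-1)^-1 = 2 :> R) //; field.
Qed.

Lemma geometric_dominated (u : nat -> R) (C : R) :
  (forall m, `|u m| <= C * 2^-1 ^+ m) ->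
  cvgn (series u) /\ `|limn (series u)| <= 2 * C.
Proof.
move=> uC.
have cb : series (fun m => C * 2^-1 ^+ m) @ \oo --> C * 2.
  have -> : series (fun m => C * 2^-1 ^+ m) =
      (fun n => C * series (fun m => 2^-1 ^+ m : R) n).
    by apply/funext => n; rewrite /series /= mulr_sumr.
  by apply: cvgMr; exact: half_geometric_cvg.
have nc : cvgn [normed series u].
  apply: (series_le_cvg _ _ uC) => [//|n|]; last exact: cvgP cb.
  by apply: le_trans (uC n); exact: normr_ge0.
split; first exact: normed_cvg.
apply: (le_trans (lim_series_norm nc)).
rewrite [2 * C]mulrC -(cvg_lim _ cb) //.
by apply: lim_series_le => //; exact: cvgP cb.
Qed.

End Taylor.

(** * Jets obtained from series and from multiplication by time *)

Section JetConstructions.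
Context {R : realType}.
Variable T : R.
Hypothesis T0 : 0 < T.
Implicit Types s : nat -> nat -> nat -> R -> R -> R -> R.

(** Time derivatives are two-sided here even at 0 and T: the individual terms of the series are
    differentiable at every t >= 0. *)
Definition jet_derive s := forall r p q t x y, t \in `[0, T] ->
  [/\ is_derive t 1 (fun t => s r p q t x y) (s r.+1 p q t x y),
      is_derive x 1 (fun x => s r p q t x y) (s r p.+1 q t x y) &
      is_derive y 1 (fun y => s r p q t x y) (s r p q.+1 t x y)].

Lemma jet_bound_derive C s r p q : jet_derive s ->
  (forall r' p' q' t x y, t \in `[0, T] ->
    (r' <= r.+2)%N -> (p' <= p.+2)%N -> (q' <= q.+2)%N ->
    `|s r' p' q' t x y| <= C) ->
  jet_bound T C s r p q.
Proof.
move=> ds sC t x y tT.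
have le2 n : (n <= n.+2)%N by rewrite -addn2 leq_addr.
split; first exact: sC.
- move=> t' t'T.
  apply: (@taylor_bound _ (fun t => s r p q t x y) (fun t => s r.+1 p q t x y)
    (fun t => s r.+2 p q t x y) `[0, T]) => [z zT|z zT|z zT||//]; [| |exact: sC|exact: tT].
  + by case: (ds r p q z x y zT).
  + by case: (ds r.+1 p q z x y zT).
- move=> x'.
  apply: (@taylor_bound _ (fun x => s r p q t x y) (fun x => s r p.+1 q t x y)
    (fun x => s r p.+2 q t x y) `]-oo, +oo[) => [z _|z _|z _|//|//]; last exact: sC.
  + by case: (ds r p q t z y tT).
  + by case: (ds r p.+1 q t z y tT).
- move=> y'.
  apply: (@taylor_bound _ (fun y => s r p q t x y) (fun y => s r p q.+1 t x y)
    (fun y => s r p q.+2 t x y) `]-oo, +oo[) => [z _|z _|z _|//|//]; last exact: sC.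
  + by case: (ds r p q t x z tT).
  + by case: (ds r p q.+1 t x z tT).
Qed.

Variable phi : nat -> nat -> nat -> nat -> R -> R -> R -> R.
Hypothesis dphi : forall m, jet_derive (phi m).
Hypothesis phi_le : forall r p q, exists C, forall m t x y, t \in `[0, T] ->
  `|phi m r p q t x y| <= C * 2^-1 ^+ m.

Definition jet_sum r p q t x y := limn (series (fun m => phi m r p q t x y)).

Lemma jet_sum_cvg r p q t x y : t \in `[0, T] ->
  series (fun m => phi m r p q t x y) @ \oo --> jet_sum r p q t x y.
Proof.
move=> tT; have [C HC] := phi_le r p q.
by have [] := geometric_dominated (fun m => HC m t x y tT).
Qed.

(** Finitely many orders are involved; the sum of the absolute values of their constants dominates
    each of them. *)
Lemma phi_le_below r p q : exists C, forall m r' p' q' t x y, t \in `[0, T] ->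
    (r' <= r)%N -> (p' <= p)%N -> (q' <= q)%N ->
    `|phi m r' p' q' t x y| <= C * 2^-1 ^+ m.
Proof.
have le (i : 'I_r.+1 * 'I_p.+1 * 'I_q.+1) : {C : R |
    forall m t x y, t \in `[0, T] ->
    `|phi m i.1.1 i.1.2 i.2 t x y| <= C * 2^-1 ^+ m}.
  exact/cid/phi_le.
exists (\sum_i `|projT1 (le i)|) => m r' p' q' t x y tT rr pp qq.
pose i := (Ordinal (rr : (r' < r.+1)%N), Ordinal (pp : (p' < p.+1)%N),
  Ordinal (qq : (q' < q.+1)%N)).
apply: (le_trans (projT2 (le i) m t x y tT)).
rewrite ler_wpM2r ?exprn_ge0 ?invr_ge0 //.
rewrite (bigD1 i) //= (le_trans (ler_norm _)) // lerDl.
exact: sumr_ge0.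
Qed.

(** The Taylor remainder is linear in the jet, so the remainders of the terms add up to the
    remainder of the sum. This replaces a theorem on termwise differentiation. *)
Lemma jet_jet_sum : jet T jet_sum.
Proof.
move=> r p q; have [C HC] := phi_le_below r.+2 p.+2 q.+2.
exists (2 * C) => t x y tT.
have jb m : jet_bound T (C * 2^-1 ^+ m) (phi m) r p q.
  by apply: jet_bound_derive => // *; apply: HC.
have tay (u u' d : nat -> R) (U U' D h : R) :
    series u @ \oo --> U -> series u' @ \oo --> U' -> series d @ \oo --> D ->
    (forall m, `|u' m - u m - h * d m| <= C * 2^-1 ^+ m * h ^+ 2) ->
    `|U' - U - h * D| <= 2 * C * h ^+ 2.
  move=> cu cu' cd H.
  have [|_] := @geometric_dominated _ (fun m => u' m - u m - h * d m) (C * h ^+ 2).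
    by move=> m; rewrite mulrAC; exact: H.
  rewrite mulrA (_ : series _ = series u' \- series u \- (fun n => h * series d n)).
    suff /cvg_lim -> : series u' \- series u \- (fun n => h * series d n) @ \oo
      --> U' - U - h * D by [].
    by apply: cvgB; [exact: cvgB | exact: cvgMr].
  by apply/funext => n; rewrite /series /= !sumrB mulr_sumr.
have cv r' p' q' t' x' y' : t' \in `[0, T] ->
  series (fun m => phi m r' p' q' t' x' y') @ \oo --> jet_sum r' p' q' t' x' y'.
  exact: jet_sum_cvg.
split.
- have [|//] := @geometric_dominated _ (fun m => phi m r p q t x y) C.
  by move=> m; have [] := jb m t x y tT.
- move=> t' t'T; apply: tay; [exact: cv..|] => m.
  by have [_ H _ _] := jb m t x y tT; exact: H.
- move=> x'; apply: tay; [exact: cv..|] => m.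
  by have [_ _ H _] := jb m t x y tT; exact: H.
- move=> y'; apply: tay; [exact: cv..|] => m.
  by have [_ _ _ H] := jb m t x y tT; exact: H.
Qed.

End JetConstructions.

(** Leibniz rule for the r-th time derivative of t s. For r = 0 the factor [r%:R] removes the
    truncated index [r.-1]. *)
Definition jet_mul_time {R : realType} (s : nat -> nat -> nat -> R -> R -> R -> R)
  r p q (t x y : R) := t * s r p q t x y + r%:R * s r.-1 p q t x y.

Lemma jet_jet_mul_time {R : realType} (T : R) s : 0 < T -> jet T s ->
  jet T (jet_mul_time s).
Proof.
move=> T0 js r p q; have [C HC] := js r p q; have [C' HC'] := js r.-1 p q.
have [D HD] := js r.+1 p q.
exists (T * `|C| + r%:R * `|C'| + (`|D| + `|C| * (1 + T))) => t x y tT.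
have [t0 tT'] : 0 <= t /\ t <= T by move: tT; rewrite in_itv /= => /andP.
have [B Bt Bx By] := HC t x y tT; have [B' Bt' Bx' By'] := HC' t x y tT.
have [BD _ _ _] := HD t x y tT.
have E0 : 0 <= `|D| + `|C| * (1 + T).
  by rewrite addr_ge0 // mulr_ge0 // addr_ge0 // ltW.
have F0 : 0 <= T * `|C| + r%:R * `|C'| by rewrite addr_ge0 // mulr_ge0 // ltW.
have lin (a b h : R) : `|a| <= C * h -> `|b| <= C' * h -> 0 <= h ->
    `|t * a + r%:R * b| <= (T * `|C| + r%:R * `|C'|) * h.
  move=> Ha Hb h0; rewrite (le_trans (ler_normD _ _)) // mulrDl !normrM lerD //.
    rewrite -mulrA ger0_norm // ler_pM //.
    by rewrite (le_trans Ha) // ler_wpM2r // ler_norm.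
  rewrite normr_nat -mulrA ler_wpM2l //.
  by rewrite (le_trans Hb) // ler_wpM2r // ler_norm.
have wk a h : a <= (T * `|C| + r%:R * `|C'|) * h -> 0 <= h ->
    a <= (T * `|C| + r%:R * `|C'| + (`|D| + `|C| * (1 + T))) * h.
  by move=> H h0; rewrite mulrDl (le_trans H) // lerDl mulr_ge0.
split.
- rewrite -[leRHS]mulr1; apply: wk => //.
  by apply: lin => //; rewrite mulr1.
- move=> t' t'T; rewrite /jet_mul_time.
  set h := t' - t; have -> : t' = t + h by rewrite /h addrCA subrr addr0.
  have tT2 : t + h \in `[0, T] by rewrite /h addrCA subrr addr0.
  have hT : `|h| <= 1 + T.
    move: tT2; rewrite in_itv /= => /andP[h1 h2].
    by rewrite ler_norml; apply/andP; split; lra.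
  have {}Bt := Bt _ tT2; have {}Bt' := Bt' _ tT2.
  rewrite [t + h - t]addrAC subrr add0r in Bt Bt'.
  have L := taylor_lipschitz Bt hT.
  set Z := s r p q (t + h) x y in Bt L *.
  set z := s r p q t x y in Bt L *.
  set d := s r.+1 p q t x y in Bt L BD *.
  set Z' := s r.-1 p q (t + h) x y in Bt' *.
  set z' := s r.-1 p q t x y in Bt' *.
  (* Besides the remainders of the two factors there is the cross term h (Z - z), quadratic in h
     since [s] is Lipschitz in time. *)
  have -> : (t + h) * Z + r%:R * Z' - (t * z + r%:R * z')
        - h * (t * d + r.+1%:R * s r.+1.-1 p q t x y)
      = (t * (Z - z - h * d) + r%:R * (Z' - z' - h * z)) + h * (Z - z).
    by rewrite -/z -natr1; ring.
  apply: (le_trans (ler_normD _ _)); rewrite [leRHS]mulrDl; apply: lerD.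
    (* For r = 0 the bracket is no Taylor remainder, because [r.-1] is then [r] itself; its factor
       is 0, and b = 0 is taken instead. *)
    have [b -> hb] : exists2 b, r%:R * (Z' - z' - h * z) = r%:R * b
        & `|b| <= C' * h ^+ 2.
      rewrite /Z' /z' /z in Bt' *; case: (r) Bt' => [|r'] Bt'; last by eexists; [reflexivity | exact: Bt'].
      exists 0; first by rewrite !mul0r.
      by rewrite normr0; apply: le_trans Bt'; exact: normr_ge0.
    by apply: lin; rewrite ?sqr_ge0.
  rewrite normrM (le_trans (ler_wpM2l _ L)) // mulrCA -expr2 real_normK ?num_real //.
  by rewrite ler_wpM2r ?sqr_ge0 // lerD2r (le_trans BD) // ler_norm.
- move=> x'; apply: wk; last exact: sqr_ge0.
  have -> : jet_mul_time s r p q t x' y - jet_mul_time s r p q t x y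
      - (x' - x) * jet_mul_time s r p.+1 q t x y =
    t * (s r p q t x' y - s r p q t x y - (x' - x) * s r p.+1 q t x y)
    + r%:R * (s r.-1 p q t x' y - s r.-1 p q t x y - (x' - x) * s r.-1 p.+1 q t x y).
    by rewrite /jet_mul_time; ring.
  by apply: lin; rewrite ?sqr_ge0.
- move=> y'; apply: wk; last exact: sqr_ge0.
  have -> : jet_mul_time s r p q t x y' - jet_mul_time s r p q t x y
      - (y' - y) * jet_mul_time s r p q.+1 t x y =
    t * (s r p q t x y' - s r p q t x y - (y' - y) * s r p q.+1 t x y)
    + r%:R * (s r.-1 p q t x y' - s r.-1 p q t x y - (y' - y) * s r.-1 p q.+1 t x y).
    by rewrite /jet_mul_time; ring.
  by apply: lin; rewrite ?sqr_ge0.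
Qed.

(** * Duhamel coefficients *)

Section Calculus.
Context {R : realType}.
Implicit Types (f g c A : R -> R).

Lemma is_derive_expRM (b t : R) :
  is_derive t 1 (fun t => expR (b * t)) (b * expR (b * t)).
Proof.
have h : is_derive t 1 (fun t : R => b * t) b.
  by apply: is_derive_eq; rewrite /GRing.scale /=; ring.
by apply: is_derive_eq (is_derive1_comp _ h) _; rewrite mulrC.
Qed.

Lemma antiderivative_exists g : continuous g ->
  exists G : R -> R, G 0 = 0 /\ forall t : R, 0 <= t -> is_derive t 1 G (g t).
Proof.
move=> cg.
(* Starting at -1 makes 0 an interior point, so the derivative is two-sided there too; subtracting F
   0 restores the normalization. *)
pose F (x : R) := (\int[lebesgue_measure]_(t in [set` `[-1, x]]) (g t))%R.
exists (fun x => F x - F 0); split; first by rewrite subrr.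
move=> t t0.
have [] := @continuous_FTC1_closed R g (-1) t (t + 1) _ _ _ (cg t).
- by rewrite ltrDl.
- apply: continuous_compact_integrable; first exact: segment_compact.
  exact: continuous_subspaceT.
- by apply: lt_le_trans t0; rewrite ltrN10.
move=> dF; rewrite derive1E => F'.
have h : is_derive t 1 F (g t) by apply: DeriveDef.
by apply: is_derive_eq; rewrite subr0.
Qed.

(* Precomposing with [max _ 0] makes continuity on [0, +oo[ enough for the
   antiderivative to be differentiable at [0] from both sides. *)
Lemma antiderivative_cid g : {G : R -> R |
  continuous (fun s : R => g (Num.max s 0)) ->
  G 0 = 0 /\ forall t : R, 0 <= t -> is_derive t 1 G (g t)}.
Proof.
apply: cid; have [cg|ncg] := pselect (continuous (fun s : R => g (Num.max s 0))).
  have [G [G0 dG]] := antiderivative_exists cg.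
  by exists G => _; split => // t t0; have := dG t t0; rewrite max_l.
by exists (fun=> 0) => /ncg.
Qed.

(** Total in [g], so that [coef] can be a plain recursion on words whose continuity is proved only
    afterwards. *)
Definition primitive g : R -> R := projT1 (antiderivative_cid g).

Lemma continuous_max0 g : (forall t : R, 0 <= t -> {for t, continuous g}) ->
  continuous (fun s : R => g (Num.max s 0)).
Proof.
move=> cg s; apply: (@continuous_comp _ _ _ (fun s : R => Num.max s 0) g).
  by apply: continuous_max; [exact: cvg_id | exact: cvg_cst].
by apply: cg; rewrite le_max lexx orbT.
Qed.

Lemma is_derive_continuous g (t d : R) : is_derive t 1 g d -> {for t, continuous g}.
Proof. by move=> [/derivable1_diffP/differentiable_continuous]. Qed.

(** Comparison with a supersolution [A]: for both signs e, the function exp(l s) (A - e c) starts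
    nonnegative and has nonnegative derivative. All coefficient bounds come from a choice of [A]. *)
Lemma duhamel_bound c A A' g (l : R) :
  (forall t : R, 0 <= t -> is_derive t 1 c (- l * c t + g t)) ->
  (forall t : R, 0 <= t -> is_derive t 1 A (A' t)) ->
  (forall t : R, 0 <= t -> `|g t| <= A' t + l * A t) ->
  `|c 0| <= A 0 -> forall t : R, 0 <= t -> `|c t| <= A t.
Proof.
move=> dc dA gA c0 t t0.
have H (e : R) : e = 1 \/ e = -1 -> e * c t <= A t.
  move=> e1.
  have ee : `|e| = 1 by case: e1 => ->; rewrite ?normrN normr1.
  pose E s := expR (l * s) * (A s - e * c s).
  have dE (s : R) : s \in `[0, +oo[ -> is_derive s 1 E
      (expR (l * s) * (A' s + l * A s - e * g s)).
    rewrite in_itv /= andbT => s0.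
    have h1 := is_derive_expRM l s; have h2 := dc s s0; have h3 := dA s s0.
    by apply: is_derive_eq; rewrite /GRing.scale /=; ring.
  have t1 : t \in `[0, +oo[ by rewrite in_itv /= t0.
  have z1 : (0 : R) \in `[0, +oo[ by rewrite in_itv /= lexx.
  have [s [s0 _] Es] := MVT_between dE z1 t1.
  have {}s0 : 0 <= s by move: s0; rewrite in_itv /= andbT.
  have : 0 <= E t.
    rewrite -[E t](subrK (E 0)) Es addr_ge0 //.
      rewrite subr0 mulr_ge0 // mulr_ge0 ?expR_ge0 // subr_ge0.
      by apply: le_trans (gA s s0); rewrite (le_trans (ler_norm _)) // normrM ee mul1r.
    rewrite /E mulr0 expR0 mul1r subr_ge0.
    by apply: le_trans c0; rewrite (le_trans (ler_norm _)) // normrM ee mul1r.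
  by rewrite /E pmulr_rge0 ?expR_gt0 // subr_ge0.
rewrite ler_norml; apply/andP; split; last by rewrite -[c t]mul1r H //; left.
by rewrite lerNl -mulN1r H //; right.
Qed.

(** The difference solves the homogeneous equation, with supersolution 0. Closed forms of
    coefficients are identified this way, without evaluating a Duhamel integral. *)
Lemma duhamel_unique c c' g (l : R) :
  (forall t : R, 0 <= t -> is_derive t 1 c (- l * c t + g t)) ->
  (forall t : R, 0 <= t -> is_derive t 1 c' (- l * c' t + g t)) ->
  c 0 = c' 0 -> forall t : R, 0 <= t -> c t = c' t.
Proof.
move=> dc dc' c0 t t0; apply/eqP; rewrite -subr_eq0 -normr_le0.
apply: (@duhamel_bound (fun t => c t - c' t) (fun=> 0) (fun=> 0) (fun=> 0) l
  _ _ _ _ t t0).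
- move=> s s0; have h1 := dc s s0; have h2 := dc' s s0.
  by apply: is_derive_eq; ring.
- by move=> s s0; rewrite normr0 mulr0 addr0.
- by rewrite c0 subrr normr0.
Qed.

End Calculus.

(** * Words of frequencies and their coefficients *)

Section Words.
Context {R : realType}.
Variable a : R.
Implicit Types (d : int) (w : seq int).

(** Half of a N_j, since each cosine is shared between the frequencies N_j and -N_j. *)
Definition amplitude d : R := a * `|d%:~R| / 2.
Definition freq w : int := \sum_(d <- w) d.
(** The eigenvalue of minus the Laplacian on the mode of the word; the summand 1 is the squared
    frequency in x_2. *)
Definition decay w : R := (freq w)%:~R ^+ 2 + 1.
Local Notation sq d := ((d%:~R : R) ^+ 2).

(* Coefficient of the iterated interaction of the modes listed in [w], the
   last one coming from the initial density and the others from the shear. *)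
Fixpoint coef w : R -> R :=
  if w is d :: w' then fun t =>
    expR (- decay w * t) * ((if w' is [::] then amplitude d else 0) +
      primitive (fun s => expR (decay w * s) *
        (amplitude d * expR (- sq d * s) * coef w' s)) t)
  else fun=> 0.

Definition coef_source w (t : R) : R :=
  if w is d :: w' then amplitude d * expR (- sq d * t) * coef w' t else 0.

Lemma coef_continuous_primitive w : (forall t : R, 0 <= t -> {for t, continuous (coef w)}) ->
  forall d (l : R), primitive (fun s => expR (l * s) *
        (amplitude d * expR (- sq d * s) * coef w s)) 0 = 0 /\
  forall t : R, 0 <= t -> is_derive t 1 (primitive (fun s => expR (l * s) *
        (amplitude d * expR (- sq d * s) * coef w s)))
        (expR (l * t) * (amplitude d * expR (- sq d * t) * coef w t)).
Proof.
move=> cw d l; apply: (projT2 (antiderivative_cid _)).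
apply: (@continuous_max0 _ (fun s => expR (l * s) * (amplitude d * expR (- sq d * s) * coef w s))).
move=> t t0; apply: cvgM; first exact: is_derive_continuous (is_derive_expRM _ _).
apply: cvgM; last exact: cw.
by apply: cvgM; [exact: cvg_cst|exact: is_derive_continuous (is_derive_expRM _ _)].
Qed.

Lemma is_derive_coef w (t : R) : 0 <= t ->
  is_derive t 1 (coef w) (- decay w * coef w t + coef_source w t).
Proof.
elim: w t => [|d w IH] t t0.
  by apply: is_derive_eq; rewrite mulr0 addr0.
have [_ /(_ t t0) h2] := coef_continuous_primitive
  (fun (t : R) t0 => is_derive_continuous (IH t t0)) d (decay (d :: w)).
have h1 := is_derive_expRM (- decay (d :: w)) t.
apply: is_derive_eq; rewrite /coef_source /= /GRing.scale /=.
set E := expR (decay (d :: w) * t).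
have -> : expR (- decay (d :: w) * t) = E^-1 by rewrite mulNr expRN.
have E0 : E != 0 by rewrite gt_eqF // expR_gt0.
by field.
Qed.

Lemma coef_cons0 d w : coef (d :: w) 0 = if w is [::] then amplitude d else 0.
Proof.
have [h _] := coef_continuous_primitive
  (fun (t : R) t0 => is_derive_continuous (is_derive_coef w t0)) d (decay (d :: w)).
by rewrite /= h mulr0 expR0 mul1r addr0.
Qed.

(* [jcoef w mu r] is the [r]-th derivative of [expR (- mu * t) * coef w t]. *)
Fixpoint jcoef w : R -> nat -> R -> R :=
  fix jw (mu : R) (r : nat) (t : R) : R :=
    match r with
    | 0%N => expR (- mu * t) * coef w t
    | r'.+1 => match w with
               | [::] => 0
               | d :: w' => - (mu + decay w) * jw mu r' t +
                            amplitude d * jcoef w' (mu + sq d) r' t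
               end
    end.

(** The source of d :: w is a multiple of exp(-d^2 t) [coef w]. Differentiating the equation again
    thus needs the derivatives for [w] with the exponent [mu] raised by d^2, and this closes the
    family. *)
Lemma is_derive_jcoef w mu r (t : R) : 0 <= t ->
  is_derive t 1 (jcoef w mu r) (jcoef w mu r.+1 t).
Proof.
move=> t0; elim: r w mu => [|r IH] [|d w] mu.
- rewrite (_ : jcoef _ _ _ = fun=> 0); last by apply/funext => s /=; rewrite mulr0.
  exact: is_derive_cst.
- have h1 := is_derive_expRM (- mu) t; have h2 := is_derive_coef (d :: w) t0.
  apply: is_derive_eq.
  rewrite [coef_source _ _]/= [jcoef _ _ 1 t]/= -/(coef (d :: w) t) /GRing.scale /=.
  have -> : jcoef w (mu + sq d) 0 t = expR (- mu * t) * expR (- sq d * t) * coef w t.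
    by rewrite -expRD -mulrDl -opprD; case: (w).
  ring.
- exact: is_derive_cst.
- have h1 := IH (d :: w) mu; have h2 := IH w (mu + sq d).
  rewrite (_ : jcoef _ _ _ = fun s => - (mu + decay (d :: w)) * jcoef (d :: w) mu r s +
     amplitude d * jcoef w (mu + sq d) r s) //.
  by apply: is_derive_eq; rewrite /GRing.scale /=; ring.
Qed.

End Words.

(** Raise x <= exp x at x = (m+1) c, c = ln 2 / (K+1), to the power K+1: the right side becomes
    2^(m+1). Using K+1 keeps c meaningful for K = 0. *)
Lemma poly_le_pow2 {R : realType} (K : nat) :
  exists C : R, 0 <= C /\ forall m : nat, m.+1%:R ^+ K <= C * 2 ^+ m.
Proof.
set c : R := ln 2 / K.+1%:R.
have l2 : 0 < ln 2 :> R by rewrite ln_gt0 // ltr1n.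
have c0 : 0 < c by rewrite divr_gt0.
exists (2 / c ^+ K.+1); split=> [|m]; first by rewrite divr_ge0 // exprn_ge0 // ltW.
apply: (@le_trans _ _ (m.+1%:R ^+ K.+1)).
  by rewrite exprS ler_peMl // ?exprn_ge0 // ler1n.
rewrite mulrAC -exprS ler_pdivlMr ?exprn_gt0 // -exprMn.
have -> : (2 : R) ^+ m.+1 = expR (m.+1%:R * c) ^+ K.+1.
  rewrite -expRM_natl (_ : _ * _ = m.+1%:R * ln 2).
    by rewrite expRM_natl lnK // posrE.
  by rewrite /c; field; rewrite addrC natr1 pnatr_eq0.
apply: lerXn2r; rewrite ?nnegrE ?expR_ge0 ?(mulr_ge0 _ (ltW c0)) //.
by apply: le_trans (expR_ge1Dx _); rewrite lerDr.
Qed.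

Lemma is_derive_big {R : realType} (I : eqType) (s : seq I) (f : I -> R -> R)
    (df : I -> R) (t : R) :
  (forall i, i \in s -> is_derive t 1 (f i) (df i)) ->
  is_derive t 1 (fun t => \sum_(i <- s) f i t) (\sum_(i <- s) df i).
Proof.
elim: s => [|i s IH] H.
  rewrite big_nil (_ : (fun _ => _) = fun=> 0); first exact: is_derive_cst.
  by apply/funext => u; rewrite big_nil.
rewrite big_cons (_ : (fun _ => _) = (fun t => f i t + \sum_(j <- s) f j t)).
  apply: is_deriveD; first by apply: H; rewrite mem_head.
  by apply: IH => j js; apply: H; rewrite inE js orbT.
by apply/funext => u; rewrite big_cons.
Qed.

(** * Bounds on coefficients and their time derivatives *)

Section CoefficientBounds.
Context {R : realType}.
Variables (a : R) (D : seq int) (B th M : R).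
Hypothesis a0 : 0 <= a.
Hypothesis th0 : 0 < th.
Hypothesis DB : forall d, d \in D -> amplitude a d <= B.
Hypothesis Dth : forall d, d \in D -> amplitude a d <= th * (d%:~R : R) ^+ 2.
Hypothesis D0 : forall d, d \in D -> d != 0.
Hypothesis DM : forall d, d \in D -> `|d%:~R| <= M.
Hypothesis D4 : (size D)%:R * th <= 4^-1.
Local Notation sq d := ((d%:~R : R) ^+ 2).
Implicit Types (w : seq int) (d : int).

Lemma amplitude_ge0 d : 0 <= amplitude a d.
Proof. by rewrite /amplitude divr_ge0 // mulr_ge0. Qed.

Lemma decay_ge0 w : 0 <= decay w :> R.
Proof. by rewrite /decay addr_ge0 // sqr_ge0. Qed.

Lemma B_ge0 d : d \in D -> 0 <= B.
Proof. by move/DB; apply: le_trans; exact: amplitude_ge0. Qed.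

(** The letter of the initial density costs B. Every other letter costs th: its factor amplitude
    exp(-d^2 t) integrates to at most amplitude / d^2, even if the decay of the word itself is given
    away. *)
Lemma coef_le m w t : size w = m.+1 -> all [in D] w -> 0 <= t ->
  `|coef a w t| <= B * th ^+ m.
Proof.
elim: m w t => [|m IH] [//|d w] t /= [sw] /andP[dD wD] t0.
  rewrite (size0nil sw) expr0 mulr1.
  apply: (le_trans _ (DB dD)).
  apply: (@duhamel_bound _ (coef a [:: d]) (fun=> amplitude a d) (fun=> 0)
    (coef_source a [:: d]) (decay [:: d]) _ _ _ _ t t0).
  - by move=> s s0; exact: is_derive_coef.
  - by move=> s s0; rewrite /coef_source mulr0 normr0 add0r mulr_ge0 ?decay_ge0 ?amplitude_ge0.
  - by rewrite coef_cons0 ger0_norm // amplitude_ge0.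
have d0 : 0 < sq d by rewrite exprn_even_gt0 //= intr_eq0 D0.
set c := B * th ^+ m * (amplitude a d / sq d).
have c0 : 0 <= c.
  by rewrite mulr_ge0 ?divr_ge0 ?amplitude_ge0 ?sqr_ge0 // mulr_ge0 ?(B_ge0 dD) // exprn_ge0 // ltW.
apply: (@le_trans _ _ (c * (1 - expR (- sq d * t)))); last first.
  apply: (@le_trans _ _ c).
    by rewrite -[leRHS]mulr1 ler_wpM2l // gerBl expR_ge0.
  rewrite exprSr mulrA ler_wpM2l //.
    by rewrite mulr_ge0 ?(B_ge0 dD) // exprn_ge0 // ltW.
  by rewrite ler_pdivrMr // Dth.
apply: (@duhamel_bound _ (coef a (d :: w)) (fun t => c * (1 - expR (- sq d * t)))
    (fun t => c * sq d * expR (- sq d * t))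
    (coef_source a (d :: w)) (decay (d :: w)) _ _ _ _ t t0).
- by move=> s s0; exact: is_derive_coef.
- move=> s s0; have h1 := is_derive_expRM (- sq d) s.
  by apply: is_derive_eq; rewrite /GRing.scale /=; ring.
- move=> s s0; rewrite /coef_source normrM [X in X * _]normrM (ger0_norm (expR_ge0 _)).
  rewrite (ger0_norm (amplitude_ge0 _)) -[leLHS]addr0 lerD //.
    have -> : c * sq d = amplitude a d * (B * th ^+ m).
      by rewrite /c; field; rewrite intr_eq0 D0.
    by rewrite mulrAC ler_wpM2r ?expR_ge0 // ler_wpM2l ?amplitude_ge0 // IH.
  rewrite mulr_ge0 ?decay_ge0 // mulr_ge0 // subr_ge0 -expR0 ler_expR.
  by rewrite mulNr oppr_le0 mulr_ge0 // sqr_ge0.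
- rewrite coef_cons0; case: (w) sw => // _ l _.
  by rewrite normr0 mulr0 expR0 subrr mulr0.
Qed.

Lemma freq_le m w : size w = m.+1 -> all [in D] w ->
  `|(freq w)%:~R : R| <= m.+1%:R * M.
Proof.
move=> <-; rewrite /freq; elim: w => [|d w IH] /=.
  by rewrite big_nil normr0 mul0r.
move=> /andP[dD wD]; rewrite big_cons rmorphD /= (le_trans (ler_normD _ _)) //.
by rewrite -natr1 mulrDl mul1r addrC lerD // ?IH // DM.
Qed.

Lemma decay_le m w : size w = m.+1 -> all [in D] w ->
  decay w <= (M ^+ 2 + 1) * m.+1%:R ^+ 2 :> R.
Proof.
move=> sw wD; have H := freq_le sw wD.
rewrite /decay mulrDl mul1r lerD //; last by rewrite exprn_ege1 // ler1n.
rewrite -real_normK ?num_real // mulrC -exprMn; apply: lerXn2r => //.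
by rewrite nnegrE (le_trans _ H).
Qed.

Lemma jcoef_nil mu r t : jcoef a [::] mu r t = 0.
Proof. by case: r => [|r] //=; rewrite mulr0. Qed.

(** Each time derivative multiplies by mu + decay, of order (m+1)^2, or passes to the shorter word
    at cost B; that word's bound has one factor th less, whence B / th. The condition on [U]
    reserves room for [mu] to grow by at most M^2 at each remaining derivative. *)
Lemma jcoef_le r mu U m w t : 0 <= mu -> mu + r%:R * M ^+ 2 <= U ->
  size w = m.+1 -> all [in D] w -> 0 <= t ->
  `|jcoef a w mu r t| <=
    B * th ^+ m * ((U + M ^+ 2 + 1 + B / th) * m.+1%:R ^+ 2) ^+ r.
Proof.
elim: r mu m w => [|r IH] mu m w mu0 muU sw wD t0.
  rewrite (_ : jcoef _ _ _ _ _ = expR (- mu * t) * coef a w t); last by case: (w).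
  rewrite expr0 mulr1 normrM (ger0_norm (expR_ge0 _)) -[leRHS]mul1r.
  apply: ler_pM; rewrite ?expR_ge0 // ?coef_le //.
  by rewrite -expR0 ler_expR mulNr oppr_le0 mulr_ge0.
case: w sw wD => [//|d w] sw wD.
have [dD wD'] : d \in D /\ all [in D] w by move: wD => /= /andP.
have Bp := B_ge0 dD.
have d0 : 0 <= sq d by rewrite sqr_ge0.
have dM : sq d <= M ^+ 2.
  rewrite -real_normK ?num_real //; apply: lerXn2r; rewrite ?nnegrE ?DM //.
  by apply: le_trans (DM dD).
have muU' : mu + sq d + r%:R * M ^+ 2 <= U.
  by apply: le_trans muU; rewrite -natr1 mulrDl mul1r -addrA lerD2l addrC lerD2l.
have muU2 : mu + r%:R * M ^+ 2 <= U.
  by apply: le_trans muU'; rewrite addrAC lerDl.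
have mU : mu <= U by apply: le_trans muU2; rewrite lerDl mulr_ge0 // sqr_ge0.
have U0 : 0 <= U by exact: le_trans mU.
set X := U + M ^+ 2 + 1 + B / th.
have X1 : 0 <= X by rewrite /X !addr_ge0 ?sqr_ge0 // divr_ge0 // ltW.
set Y := (X * m.+1%:R ^+ 2) ^+ r.
have Y0 : 0 <= Y by rewrite exprn_ge0 // mulr_ge0 // sqr_ge0.
have m1 : 1 <= m.+1%:R ^+ 2 :> R by rewrite exprn_ege1 // ler1n.
have t1 : `|- (mu + decay (d :: w)) * jcoef a (d :: w) mu r t| <=
    (U + M ^+ 2 + 1) * m.+1%:R ^+ 2 * (B * th ^+ m * Y).
  rewrite normrM normrN; apply: ler_pM => //; last exact: IH.
  rewrite ger0_norm; last by rewrite addr_ge0 // decay_ge0.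
  rewrite -addrA mulrDl lerD //; last exact: decay_le.
  by rewrite (le_trans mU) // ler_peMr.
have t2 : `|amplitude a d * jcoef a w (mu + sq d) r t| <=
    (B / th) * m.+1%:R ^+ 2 * (B * th ^+ m * Y).
  case: m sw @Y Y0 m1 t1 => [|m] sw Y Y0 m1 t1.
    move: sw => [/size0nil ->]; rewrite jcoef_nil mulr0 normr0.
    rewrite mulr_ge0 //; first by rewrite mulr_ge0 // divr_ge0 // ltW.
    by rewrite mulr_ge0 // mulr_ge0.
  move: sw => [sw].
  rewrite normrM ger0_norm ?amplitude_ge0 //.
  have -> : B / th * m.+2%:R ^+ 2 * (B * th ^+ m.+1 * Y) =
     B * (m.+2%:R ^+ 2 * (B * th ^+ m * Y)).
    by rewrite [th ^+ m.+1]exprS; field; rewrite gt_eqF.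
  apply: ler_pM; rewrite ?amplitude_ge0 ?DB //.
  apply: (@le_trans _ _ (B * th ^+ m * Y)); last first.
    by rewrite ler_peMl // !mulr_ge0 // exprn_ge0 // ltW.
  apply: (le_trans (IH _ _ _ (addr_ge0 mu0 d0) muU' sw wD' t0)).
  rewrite ler_wpM2l //; first by rewrite mulr_ge0 // exprn_ge0 // ltW.
  apply: lerXn2r; rewrite ?nnegrE ?mulr_ge0 ?sqr_ge0 //.
  rewrite ler_wpM2l //; apply: lerXn2r; rewrite ?nnegrE //.
  by rewrite ler_nat.
rewrite (_ : jcoef _ _ _ _ _ = - (mu + decay (d :: w)) * jcoef a (d :: w) mu r t
  + amplitude a d * jcoef a w (mu + sq d) r t) //.
rewrite (le_trans (ler_normD _ _)) // (le_trans (lerD t1 t2)) //.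
by rewrite -!mulrDl -/X [_ ^+ r.+1]exprS -/Y mulrCA.
Qed.

(** The index counts interactions with the shear; the word has one more letter, for the initial
    density. *)
Fixpoint words (m : nat) : seq (seq int) :=
  if m is m'.+1 then [seq d :: w | d <- D, w <- words m']
  else [seq [:: d] | d <- D].

Lemma mem_words m w : w \in words m -> size w = m.+1 /\ all [in D] w.
Proof.
elim: m w => [|m IH] w /=.
  by move=> /mapP[d dD ->]; rewrite /= dD.
by move=> /allpairsP[[d w'] /= [dD /IH[sw wD] ->]] /=; rewrite sw dD.
Qed.

Lemma size_words m : size (words m) = (size D ^ m.+1)%N.
Proof.
elim: m => [|m IH] /=; first by rewrite size_map expn1.
by rewrite size_allpairs IH -expnS.
Qed.

(* The [m]-th term of the Duhamel expansion of the density, with its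
   derivatives of order [r] in time, [p] in the first and [q] in the second
   space variable. *)
Definition block m r p q (t x y : R) : R :=
  \sum_(w <- words m) jcoef a w 0 r t *
    ((freq w)%:~R ^+ p * cos ((freq w)%:~R * x + p%:R * (pi / 2))) *
    sin (y + q%:R * (pi / 2) - m%:R * (pi / 2)).

Lemma norm_sin_le1 (x : R) : `|sin x| <= 1.
Proof. by rewrite ler_norml sin_geN1 sin_le1. Qed.

Lemma norm_cos_le1 (x : R) : `|cos x| <= 1.
Proof. by rewrite ler_norml cos_geN1 cos_le1. Qed.

Lemma block_le_words C m r p q t x y :
  (forall w, w \in words m -> `|jcoef a w 0 r t| * `|(freq w)%:~R| ^+ p <= C) ->
  `|block m r p q t x y| <= (size D)%:R ^+ m.+1 * C.
Proof.
move=> H; rewrite /block (le_trans (ler_norm_sum _ _ _)) //.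
have -> : (size D)%:R ^+ m.+1 * C = \sum_(w <- words m) C.
  by rewrite big_const_seq count_predT iter_addr_0 size_words -[RHS]mulr_natl natrX.
rewrite big_seq [leRHS]big_seq; apply: ler_sum => w wD.
rewrite normrM [X in X * _]normrM [X in _ * X * _]normrM normrX.
rewrite -[leRHS]mulr1; apply: ler_pM => //; last exact: norm_sin_le1.
apply: le_trans (H w wD); rewrite -[leRHS]mulr1 mulrA; apply: ler_pM => //.
exact: norm_cos_le1.
Qed.



End CoefficientBounds.

(** * The scalar equation *)

Section Phases.
Context {R : realType}.
Implicit Types x y k b : R.

(** Writing differentiation as a phase shift by pi/2 gives derivatives of all orders a single
    formula. *)
Lemma is_derive_cos_phase k b x :
  is_derive x 1 (fun x => cos (k * x + b)) (k * cos (k * x + b + pi / 2)).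
Proof.
have h : is_derive x 1 (fun x : R => k * x + b) k.
  by apply: is_derive_eq; rewrite /GRing.scale /=; ring.
by apply: is_derive_eq (is_derive1_comp _ h) _; rewrite cosDpihalf mulrC.
Qed.

Lemma is_derive_sin_phase b y :
  is_derive y 1 (fun y => sin (y + b)) (sin (y + b + pi / 2)).
Proof.
have h : is_derive y 1 (fun y : R => y + b) 1.
  by apply: is_derive_eq; rewrite addr0.
by apply: is_derive_eq (is_derive1_comp _ h) _; rewrite sinDpihalf mulr1.
Qed.

End Phases.

Local Arguments jcoef : simpl never.
Local Arguments coef : simpl never.

Section Density.
Context {R : realType}.
Variables (a : R) (D : seq int) (B th M : R).
Hypothesis a0 : 0 <= a.
Hypothesis th0 : 0 < th.
Hypothesis DB : forall d, d \in D -> amplitude a d <= B.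
Hypothesis Dth : forall d, d \in D -> amplitude a d <= th * (d%:~R : R) ^+ 2.
Hypothesis D0 : forall d, d \in D -> d != 0.
Hypothesis DM : forall d, d \in D -> `|d%:~R| <= M.
Hypothesis D4 : (size D)%:R * th <= 4^-1.
Hypothesis Dsym : perm_eq (map -%R D) D.
Variable T : R.
Hypothesis T0 : 0 < T.
Local Notation sq d := ((d%:~R : R) ^+ 2).

Lemma block_jet_derive m : jet_derive T (block a D m).
Proof.
move=> r p q t x y tT.
have t0 : 0 <= t by move: tT; rewrite in_itv /= => /andP[].
rewrite /block; split.
- apply: is_derive_big => w _; have h := is_derive_jcoef a w 0 r t0.
  by apply: is_derive_eq; rewrite /GRing.scale /=; ring.
- apply: is_derive_big => w _.
  have h := is_derive_cos_phase (freq w)%:~R (p%:R * (pi / 2)) x.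
  apply: is_derive_eq; rewrite /GRing.scale /=.
  rewrite (_ : (freq w)%:~R * x + p.+1%:R * (pi / 2) =
    (freq w)%:~R * x + p%:R * (pi / 2) + pi / 2); first by rewrite exprSr; ring.
  by rewrite -natr1; ring.
- apply: is_derive_big => w _.
  have h := is_derive_sin_phase (q%:R * (pi / 2) - m%:R * (pi / 2)) y.
  under eq_fun do rewrite -addrA.
  apply: is_derive_eq; rewrite /GRing.scale /=.
  rewrite (_ : y + q.+1%:R * (pi / 2) - m%:R * (pi / 2) =
    y + (q%:R * (pi / 2) - m%:R * (pi / 2)) + pi / 2); first ring.
  by rewrite -natr1; ring.
Qed.

(** There are (size D)^(m+1) words, each contributing B th^m times a power 2r + p of m+1: two per
    time derivative, one per derivative in x. The ratio is at most 1/4, and 2^m absorbs the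
    power. *)
Lemma block_geometric r p q : exists C, forall m t x y, t \in `[0, T] ->
  `|block a D m r p q t x y| <= C * 2^-1 ^+ m.
Proof.
(* Without a letter the signs of [B] and [M] are unknown, but then every block is an empty sum. *)
have [D_nil|[d dD]] : D = [::] \/ exists d, d \in D.
  by case: (D) => [|d s]; [left|right; exists d; rewrite mem_head].
  exists 0 => m t x y _; rewrite /block D_nil.
  by case: m => [|m] /=; rewrite big_nil normr0 mul0r.
have Bp : 0 <= B by apply: le_trans (DB dD); rewrite divr_ge0 // mulr_ge0.
have M0 : 0 <= M by apply: le_trans (DM dD).
have [K [K0 HK]] := @poly_le_pow2 R (2 * r + p)%N.
set X := r%:R * M ^+ 2 + M ^+ 2 + 1 + B / th.
have X0 : 0 <= X.
  by rewrite /X !addr_ge0 ?mulr_ge0 ?sqr_ge0 // invr_ge0 ltW.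
set n : R := (size D)%:R.
exists (n * B * X ^+ r * M ^+ p * K) => m t x y tT.
have t0 : 0 <= t by move: tT; rewrite in_itv /= => /andP[].
pose Cm := B * th ^+ m * (X * m.+1%:R ^+ 2) ^+ r * (m.+1%:R * M) ^+ p.
apply: (@le_trans _ _ (n ^+ m.+1 * Cm)).
  apply: block_le_words => w /mem_words [sw wD].
  apply: ler_pM; rewrite ?exprn_ge0 //.
    by apply: (jcoef_le a0 th0 DB Dth D0 DM) => //; rewrite add0r.
  apply: lerXn2r; rewrite ?nnegrE ?mulr_ge0 //.
  exact: (freq_le DM sw wD).
have -> : n ^+ m.+1 * Cm =
    n * B * X ^+ r * M ^+ p * ((n * th) ^+ m * m.+1%:R ^+ (2 * r + p)).
  by rewrite /Cm exprD exprM !exprMn exprS; ring.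
rewrite -[X in _ <= X]mulrA ler_wpM2l //.
  by rewrite !mulr_ge0 ?exprn_ge0.
apply: (@le_trans _ _ (4^-1 ^+ m * (K * 2 ^+ m))).
  apply: ler_pM; rewrite ?exprn_ge0 ?HK //; first by rewrite mulr_ge0 // ltW.
  by apply: lerXn2r; rewrite ?nnegrE ?mulr_ge0 // ltW.
rewrite mulrCA -exprMn (_ : 4^-1 * 2 = 2^-1) //; last by field.
Qed.

Definition shear t x : R := \sum_(d <- D) amplitude a d * expR (- sq d * t) * cos (d%:~R * x).

Lemma amplitudeN d : amplitude a (- d) = amplitude a d.
Proof. by rewrite /amplitude mulrNz normrN. Qed.

Lemma sum_odd (g : int -> R) : (forall d, g (- d) = - g d) ->
  \sum_(d <- D) g d = 0.
Proof.
move=> gN; have : \sum_(d <- D) g d = - \sum_(d <- D) g d.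
  rewrite -{1}(perm_big _ Dsym) big_map -sumrN.
  by apply: eq_bigr => d _; exact: gN.
by move=> /eqP; rewrite -addr_eq0 -mulr2n mulrn_eq0 /= => /eqP.
Qed.

(** In the expansion of cos((d + k) x) the sine part is odd in d and cancels over the symmetric
    list. So multiplication by the shear amounts to prefixing a letter to the word. *)
Lemma shear_mode t x k :
  \sum_(d <- D) amplitude a d * expR (- sq d * t) * cos ((d%:~R + k) * x) =
  shear t x * cos (k * x).
Proof.
under eq_bigr do rewrite mulrDl cosD mulrBr mulrA [X in _ - X]mulrA.
rewrite sumrB -!mulr_suml [X in _ - X * _]sum_odd ?mul0r ?subr0 // => d.
by rewrite amplitudeN mulrNz sqrrN [- _ * x]mulNr sinN mulrN.
Qed.

Lemma jcoef0 w mu t : jcoef a w mu 0 t = expR (- mu * t) * coef a w t.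
Proof. by case: w. Qed.

Lemma cos_pi2 x : cos (x + 2%:R * (pi / 2)) = - cos x :> R.
Proof. by rewrite (_ : 2%:R * (pi / 2) = pi) ?cosDpi //; field. Qed.

Lemma sin_pi2 x : sin (x + 2%:R * (pi / 2)) = - sin x :> R.
Proof. by rewrite (_ : 2%:R * (pi / 2) = pi) ?sinDpi //; field. Qed.

Lemma jcoef1 d w t : jcoef a (d :: w) 0 1 t =
  - decay (d :: w) * coef a (d :: w) t + amplitude a d * expR (- sq d * t) * coef a w t.
Proof.
rewrite (_ : jcoef _ _ _ _ _ = - (0 + decay (d :: w)) * jcoef a (d :: w) 0 0 t
  + amplitude a d * jcoef a w (0 + sq d) 0 t) // !jcoef0 !add0r oppr0 mul0r expR0.
by rewrite mul1r mulrA.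
Qed.

Definition block_term m (c k x y : R) := c * cos (k * x) * sin (y - m%:R * (pi / 2)).

(** The last identity explains the phase -m pi/2: a derivative in y produces minus the phase of
    block m+1, and this sign cancels the one in -v d_2. *)
Lemma block_termE m t x y :
  [/\ block a D m 0 0 0 t x y = \sum_(w <- words D m)
        block_term m (coef a w t) (freq w)%:~R x y,
      block a D m 0 2 0 t x y = \sum_(w <- words D m)
        block_term m (- (freq w)%:~R ^+ 2 * coef a w t) (freq w)%:~R x y,
      block a D m 0 0 2 t x y = \sum_(w <- words D m)
        block_term m (- coef a w t) (freq w)%:~R x y &
      block a D m 0 0 1 t x y = \sum_(w <- words D m)
        - block_term m.+1 (coef a w t) (freq w)%:~R x y].
Proof.
rewrite /block /block_term; split; apply: eq_bigr => w _;
  rewrite !jcoef0 oppr0 (mul0r t) expR0 mul1r ?mulr0n ?(mul0r (pi / 2)) ?addr0 ?expr0 ?mul1r ?cos_pi2 //.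
- by ring.
- by rewrite [y + 2%:R * _ - _]addrAC sin_pi2; ring.
- rewrite (_ : y + pi / 2 - m%:R * (pi / 2) = y - m.+1%:R * (pi / 2) + pi).
    by rewrite sinDpi; ring.
  by rewrite -natr1; field.
Qed.

Lemma block_time m t x y : block a D m 1 0 0 t x y =
  \sum_(w <- words D m) block_term m (jcoef a w 0 1 t) (freq w)%:~R x y.
Proof.
rewrite /block /block_term; apply: eq_bigr => w _.
by rewrite ?mulr0n ?(mul0r (pi / 2)) ?addr0 ?expr0 ?mul1r.
Qed.

Lemma block0_eq t x y :
  block a D 0 1 0 0 t x y = block a D 0 0 2 0 t x y + block a D 0 0 0 2 t x y.
Proof.
have [_ -> -> _] := block_termE 0 t x y.
rewrite block_time -big_split /= !big_map; apply: eq_bigr => d _.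
by rewrite jcoef1 (_ : coef a [::] t = 0) // /decay /block_term; ring.
Qed.

Lemma blockS_eq m t x y :
  block a D m.+1 1 0 0 t x y = block a D m.+1 0 2 0 t x y + block a D m.+1 0 0 2 t x y
    - shear t x * block a D m 0 0 1 t x y.
Proof.
have [_ -> -> _] := block_termE m.+1 t x y; have [_ _ _ ->] := block_termE m t x y.
rewrite block_time mulr_sumr -sumrN.
rewrite [X in _ + X](_ : _ = \sum_(w <- words D m) \sum_(d <- D)
   amplitude a d * expR (- sq d * t) * cos ((d%:~R + (freq w)%:~R) * x) *
   (coef a w t * sin (y - m.+1%:R * (pi / 2)))).
  rewrite -big_split /= !big_allpairs_dep /= [X in _ + X]exchange_big -big_split /=.
  apply: eq_bigr => d _; rewrite -big_split; apply: eq_bigr => w _ /=.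
  rewrite jcoef1 /decay /block_term [freq (d :: w)]big_cons -/(freq w) rmorphD /=.
  by ring.
by apply: eq_bigr => w _; rewrite -mulr_suml shear_mode /block_term; ring.
Qed.

End Density.

(** * The Boussinesq solution *)

Lemma cosD_int2pi {R : realType} (k : int) (x : R) :
  cos (x + k%:~R * (2 * pi)) = cos x.
Proof.
have H (n : nat) (y : R) : cos (y + n%:R * (2 * pi)) = cos y.
  rewrite -[RHS](periodicn (@cosD2pi R) n y); congr (cos (y + _)).
  by rewrite -[pi *+ 2]mulr_natl -[X in _ = X]mulr_natl.
case: k => n; first exact: H.
by rewrite NegzE mulrNz mulNr -[LHS](H n.+1) addrNK.
Qed.

Section VectorCalculus.
Context {R : realType}.

Lemma sum_ord3 (V : zmodType) (F : 'I_3 -> V) :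
  \sum_(i < 3) F i = F 0 + F 1 + F ord_max.
Proof.
rewrite !big_ord_recr big_ord0 /= add0r.
by congr (F _ + F _ + F _); apply/val_inj.
Qed.

Lemma ord3P (P : 'I_3 -> Prop) : P 0 -> P 1 -> P ord_max -> forall i, P i.
Proof.
move=> P0 P1 P2 [[|[|[|//]]] i3].
- by rewrite (_ : Ordinal i3 = 0) //; exact/val_inj.
- by rewrite (_ : Ordinal i3 = 1) //; exact/val_inj.
- by rewrite (_ : Ordinal i3 = ord_max) //; exact/val_inj.
Qed.

Lemma is_derive_scalel (f : 'rV[R]_3 -> R) (v : 'rV[R]_3) x w l :
  is_derive x w f l -> is_derive x w (fun x => f x *: v) (l *: v).
Proof.
move=> [fd fl].
have h' : (fun h : R => h^-1 *: (((fun x => f x *: v) \o shift x) (h *: w) - f x *: v)) @ 0^' --> (l *: v).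
  rewrite (_ : (fun h : R => _) =
      (fun h : R => (h^-1 *: ((f \o shift x) (h *: w) - f x)) *: v)).
    by apply: cvgZl; rewrite -fl; exact: fd.
  by apply/funext => s; rewrite /= -scalerBl !scalerA.
by apply: DeriveDef; [apply: cvgP; exact: h' | exact: cvg_lim h'].
Qed.

Variables (T : R) (s s' : nat -> nat -> nat -> R -> R -> R -> R).
Hypothesis js : jet T s.
Hypothesis js' : jet T s'.
Variables (t : R) (tT : t \in `[0, T]).

Lemma partial_jet r p q i :
  partial i (fun x : 'rV[R]_3 => s r p q t (x 0 0) (x 0 1)) = jet_dx s r p q i t.
Proof.
by apply/funext => x; rewrite /partial; have [_ ->] := jet_is_derive r p q x i js tT.
Qed.

Lemma partial_jet_vec r p q r' p' q' v v' i :
  partial i (fun x : 'rV[R]_3 => s r p q t (x 0 0) (x 0 1) *: v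
                               + s' r' p' q' t (x 0 0) (x 0 1) *: v' : 'rV[R]_3) =
  (fun x => jet_dx s r p q i t x *: v + jet_dx s' r' p' q' i t x *: v').
Proof.
apply/funext => x; rewrite /partial.
have h := is_derive_scalel v (jet_is_derive r p q x i js tT).
have h' := is_derive_scalel v' (jet_is_derive r' p' q' x i js' tT).
by have [_ ->] := is_deriveD h h'.
Qed.

End VectorCalculus.

Section Solution.
Context {R : realType}.
Variables (a : R) (D : seq int) (B th M : R).
Hypothesis a0 : 0 <= a.
Hypothesis th0 : 0 < th.
Hypothesis DB : forall d, d \in D -> amplitude a d <= B.
Hypothesis Dth : forall d, d \in D -> amplitude a d <= th * (d%:~R : R) ^+ 2.
Hypothesis D0 : forall d, d \in D -> d != 0.
Hypothesis DM : forall d, d \in D -> `|d%:~R| <= M.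
Hypothesis D4 : (size D)%:R * th <= 4^-1.
Hypothesis Dsym : perm_eq (map -%R D) D.
Variable T : R.
Hypothesis T0 : 0 < T.
Local Notation sq d := ((d%:~R : R) ^+ 2).

Definition shear_jet (r p q : nat) (t x y : R) : R :=
  if q is 0%N then
    \sum_(d <- D) (- sq d) ^+ r * (d%:~R ^+ p * (amplitude a d *
       (expR (- sq d * t) * cos (d%:~R * x + p%:R * (pi / 2)))))
  else 0.

Lemma shear_jet_derive : jet_derive T shear_jet.
Proof.
move=> r p [|q] t x y tT; split; try exact: is_derive_cst.
- apply: is_derive_big => d _; have h := is_derive_expRM (- sq d) t.
  by apply: is_derive_eq; rewrite /GRing.scale /= [_ ^+ r.+1]exprSr; ring.
- apply: is_derive_big => d _.
  have h := is_derive_cos_phase (d%:~R : R) (p%:R * (pi / 2)) x.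
  apply: is_derive_eq; rewrite /GRing.scale /=.
  rewrite (_ : d%:~R * x + p.+1%:R * (pi / 2) =
    d%:~R * x + p%:R * (pi / 2) + pi / 2); first by rewrite [_ ^+ p.+1]exprSr; ring.
  by rewrite -natr1; ring.
Qed.

Lemma jet_shear_jet : jet T shear_jet.
Proof.
move=> r p q.
pose G r p : R := \sum_(d <- D) sq d ^+ r * (`|d%:~R| ^+ p * amplitude a d).
have G0 r' p' : 0 <= G r' p'.
  by apply: sumr_ge0 => d _; apply: mulr_ge0; [exact/exprn_ge0/sqr_ge0|apply: mulr_ge0; [exact: exprn_ge0|exact: amplitude_ge0]].
have GC r' p' q' t x y : t \in `[0, T] -> `|shear_jet r' p' q' t x y| <= G r' p'.
  move=> tT; case: q' => [|q'] /=; last by rewrite normr0.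
  apply: (le_trans (ler_norm_sum _ _ _)); apply: ler_sum => d _.
  rewrite normrM normrX normrN (ger0_norm (sqr_ge0 _)).
  apply: ler_wpM2l; first exact/exprn_ge0/sqr_ge0.
  rewrite normrM normrX; apply: ler_wpM2l; first exact: exprn_ge0.
  rewrite normrM (ger0_norm (amplitude_ge0 a0 _)) -[leRHS]mulr1.
  apply: ler_wpM2l; first exact: amplitude_ge0.
  rewrite normrM (ger0_norm (expR_ge0 _)) -[leRHS]mulr1.
  apply: ler_pM; rewrite ?expR_ge0 ?norm_cos_le1 //.
  rewrite -expR0 ler_expR mulNr oppr_le0 mulr_ge0 ?sqr_ge0 //.
  by move: tT; rewrite in_itv /= => /andP[].
exists (\sum_(i < r.+3) \sum_(j < p.+3) G i j).
apply: jet_bound_derive; first exact: shear_jet_derive.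
move=> r' p' q' t x y tT rr pp _; apply: (le_trans (GC _ _ _ _ _ _ tT)).
rewrite (bigD1 (Ordinal (rr : (r' < r.+3)%N))) //= (bigD1 (Ordinal (pp : (p' < p.+3)%N))) //=.
rewrite -addrA lerDl addr_ge0 //; first by apply: sumr_ge0.
by apply: sumr_ge0 => i _; apply: sumr_ge0.
Qed.

Lemma shear_jetE t x y : shear_jet 0 0 0 t x y = shear a D t x.
Proof.
apply: eq_bigr => d _; rewrite !expr0 !mul1r mulrA.
by rewrite (_ : 0%:R * (pi / 2) = 0) ?addr0 // mul0r.
Qed.

Lemma shear_jet_heat t x y : shear_jet 1 0 0 t x y = shear_jet 0 2 0 t x y.
Proof.
apply: eq_bigr => d _; rewrite cos_pi2 (_ : 0%:R * (pi / 2) = 0) ?mul0r // addr0.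
by ring.
Qed.

Definition density_jet := jet_sum (block a D).

Lemma jet_density_jet : jet T density_jet.
Proof.
apply: jet_jet_sum; first exact: block_jet_derive.
exact: (block_geometric a0 th0 DB Dth D0 DM D4 T).
Qed.

Lemma density_jet_eq t x y : t \in `[0, T] ->
  density_jet 1 0 0 t x y = density_jet 0 2 0 t x y + density_jet 0 0 2 t x y
    - shear a D t x * density_jet 0 0 1 t x y.
Proof.
move=> tT.
have c r p q : series (fun m => block a D m r p q t x y) @ \oo --> density_jet r p q t x y.
  apply: (jet_sum_cvg (T := T)) => //.
  exact: (block_geometric a0 th0 DB Dth D0 DM D4 T).
pose S r p q := series (fun m => block a D m r p q t x y).
(* Block m+1 is forced by block m and block 0 by nothing, so n+1 blocks are matched with n sources;
   the shift disappears in the limit. *)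
have E : (fun n => S 1%N 0%N 0%N n.+1) =
    (fun n => S 0%N 2%N 0%N n.+1 + S 0%N 0%N 2%N n.+1 - shear a D t x * S 0%N 0%N 1%N n).
  apply/funext => n; rewrite /S /series /=.
  elim: n => [|n IH].
    by rewrite !big_nat1 block0_eq big_geq // mulr0 subr0.
  rewrite big_nat_recr //= IH blockS_eq // ![\sum_(0 <= _ < n.+2) _]big_nat_recr //=.
  by rewrite [\sum_(0 <= _ < n.+1) block _ _ _ 0 0 1 _ _ _]big_nat_recr //=; ring.
have cs r p q : (fun n => S r p q n.+1) @ \oo --> density_jet r p q t x y.
  by rewrite cvg_shiftS; exact: c.
apply: (@cvg_unique _ (@norm_hausdorff _ _) _ _ _ _ (cs 1%N 0%N 0%N)).
rewrite E; apply: cvgB; first by apply: cvgD; exact: cs.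
by apply: cvgMr; exact: c.
Qed.

Definition density t (x : 'rV[R]_3) : R := density_jet 0 0 0 t (x 0 0) (x 0 1).

Definition velocity t (x : 'rV[R]_3) : 'rV[R]_3 :=
  shear a D t (x 0 0) *: 'e_1 + (t * density t x) *: e3 R.


Lemma block_periodic m t x y :
  block a D m 0 0 0 t (x + 2 * pi) y = block a D m 0 0 0 t x y /\
  block a D m 0 0 0 t x (y + 2 * pi) = block a D m 0 0 0 t x y.
Proof.
have [E _ _ _] := block_termE a D m t (x + 2 * pi) y.
have [E' _ _ _] := block_termE a D m t x (y + 2 * pi).
have [E0 _ _ _] := block_termE a D m t x y.
rewrite E E' E0 /block_term; split; apply: eq_bigr => w _.
  by rewrite mulrDr cosD_int2pi.
by rewrite addrAC [2 * pi]mulr_natl sinD2pi.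
Qed.

Lemma coord_shift (x : 'rV[R]_3) (h : R) :
  [/\ (x + h *: 'e_0) 0 0 = x 0 0 + h, (x + h *: 'e_0) 0 1 = x 0 1 &
      (x + h *: 'e_1) 0 0 = x 0 0] /\
  [/\ (x + h *: 'e_1) 0 1 = x 0 1 + h,
      (x + h *: 'e_ord_max) 0 0 = x 0 0 & (x + h *: 'e_ord_max) 0 1 = x 0 1].
Proof. by split; split; rewrite !mxE /= ?mulr1 ?mulr0 ?addr0. Qed.

Lemma density_periodic t : Defs.periodic (density t).
Proof.
have [e1 e2] : (forall x y, density_jet 0 0 0 t (x + 2 * pi) y = density_jet 0 0 0 t x y)
    /\ (forall x y, density_jet 0 0 0 t x (y + 2 * pi) = density_jet 0 0 0 t x y).
  by split=> x y; rewrite /density_jet /jet_sum; congr (limn (series _));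
    apply/funext => m; have [] := block_periodic m t x y.
apply: ord3P => x; rewrite /density; have [[h1 h2 h3] [h4 h5 h6]] := coord_shift x (2 * pi).
- by rewrite h1 h2 e1.
- by rewrite h3 h4 e2.
- by rewrite h5 h6.
Qed.

Lemma shear_periodic t : Defs.periodic (fun x : 'rV[R]_3 => shear a D t (x 0 0)).
Proof.
apply: ord3P => x; have [[h1 _ h3] [_ h5 _]] := coord_shift x (2 * pi);
  rewrite ?h1 ?h3 ?h5 //.
by apply: eq_bigr => d _; rewrite mulrDr cosD_int2pi.
Qed.

Lemma velocity_periodic t : Defs.periodic (velocity t).
Proof.
by move=> i x; rewrite /velocity (density_periodic t i x) (shear_periodic t i x).
Qed.

Lemma velocityE t x : velocity t x =
  shear_jet 0 0 0 t (x 0 0) (x 0 1) *: 'e_1 +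
  jet_mul_time density_jet 0 0 0 t (x 0 0) (x 0 1) *: 'e_ord_max.
Proof.
rewrite /velocity shear_jetE /jet_mul_time /e3 (_ : 0%:R = 0) // mul0r addr0 //.
Qed.

Lemma velocity_coord t x : [/\ velocity t x 0 0 = 0,
  velocity t x 0 1 = shear a D t (x 0 0) & velocity t x 0 ord_max = t * density t x].
Proof.
by split; rewrite !mxE /= ?mulr1 ?mulr0 ?addr0 ?add0r.
Qed.

Lemma smooth_density : smooth_periodic T density.
Proof.
split; last by move=> *; exact: density_periodic.
by move=> k; apply: Ck_jet => //; exact: jet_density_jet.
Qed.

Lemma jet_momentum : jet T (jet_mul_time density_jet).
Proof. exact/jet_jet_mul_time/jet_density_jet. Qed.

Lemma smooth_velocity : smooth_periodic T velocity.
Proof.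
split; last by move=> *; exact: velocity_periodic.
move=> k.
apply: (Ck_ext T0 (f := fun t x => shear_jet 0 0 0 t (x 0 0) (x 0 1) *: 'e_1 +
  jet_mul_time density_jet 0 0 0 t (x 0 0) (x 0 1) *: 'e_ord_max)).
  by move=> t x _; rewrite velocityE.
apply: Ck_add => //; apply: Ck_scalel => //; apply: Ck_jet => //.
  exact: jet_shear_jet.
exact: jet_momentum.
Qed.

Lemma smooth0 : smooth_periodic T (fun _ (_ : 'rV[R]_3) => 0 : R).
Proof. by split => // k; apply: (Ck_jet T0 k 0 0 0 (jet0 T)). Qed.

Lemma gradient0 (x : 'rV[R]_3) : gradient (fun=> 0 : R) x = 0.
Proof. by apply/rowP => i; rewrite !mxE /partial derive_cst. Qed.

Lemma dt_density t x : t \in `[0, T] ->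
  dt T density t x = density_jet 1 0 0 t (x 0 0) (x 0 1).
Proof.
by move=> tT; apply: is_dt_dt => //; apply: jet_is_dt => //; exact: jet_density_jet.
Qed.

Lemma dt_velocity t x : t \in `[0, T] ->
  dt T velocity t x = shear_jet 1 0 0 t (x 0 0) (x 0 1) *: 'e_1 +
    jet_mul_time density_jet 1 0 0 t (x 0 0) (x 0 1) *: 'e_ord_max.
Proof.
move=> tT; apply: is_dt_dt => //.
have h1 : is_dt T (fun t x => shear_jet 0 0 0 t (x 0 0) (x 0 1)) t x
  (shear_jet 1 0 0 t (x 0 0) (x 0 1)) by apply: jet_is_dt => //; exact: jet_shear_jet.
have h2 : is_dt T (fun t x => jet_mul_time density_jet 0 0 0 t (x 0 0) (x 0 1)) t x
  (jet_mul_time density_jet 1 0 0 t (x 0 0) (x 0 1)) by apply: jet_is_dt => //; exact: jet_momentum.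
rewrite /is_dt (_ : time_quotient _ _ _ =
  (fun s => time_quotient (fun t x => shear_jet 0 0 0 t (x 0 0) (x 0 1)) t x s *: 'e_1
  + time_quotient (fun t x => jet_mul_time density_jet 0 0 0 t (x 0 0) (x 0 1)) t x s *: 'e_ord_max)).
  by apply: cvgD; apply: cvgZl.
apply/funext => s; rewrite /time_quotient !velocityE.
by rewrite opprD addrACA -!scalerBl scalerDr !scalerA.
Qed.

Lemma laplacian_jet s t (x : 'rV[R]_3) : jet T s -> t \in `[0, T] ->
  laplacian (fun x => s 0%N 0%N 0%N t (x 0 0) (x 0 1)) x =
  s 0%N 2%N 0%N t (x 0 0) (x 0 1) + s 0%N 0%N 2%N t (x 0 0) (x 0 1).
Proof.
move=> js tT; rewrite /laplacian sum_ord3 !(partial_jet js tT 0 0 0).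
rewrite (partial_jet js tT 0 1 0 0) (partial_jet js tT 0 0 1 1).
by rewrite /partial derive_cst addr0.
Qed.

Local Arguments shear_jet : simpl never.

Lemma velocity_solution : boussinesq_solution T velocity density.
Proof.
exists (fun _ _ => 0); split.
- exact: smooth_velocity.
- exact: smooth_density.
- exact: smooth0.
move=> t x tT.
have js := jet_density_jet; have jm := jet_momentum; have jv := jet_shear_jet.
have [u0 u1 u2] := velocity_coord t x.
have vE : velocity t = (fun x => shear_jet 0 0 0 t (x 0 0) (x 0 1) *: 'e_1 +
    jet_mul_time density_jet 0 0 0 t (x 0 0) (x 0 1) *: 'e_ord_max).
  by apply/funext => z; exact: velocityE.
split.
- rewrite gradient0 addr0 dt_velocity // /advection sum_ord3 u0 u1 u2.
  rewrite /laplacian sum_ord3 vE !(partial_jet_vec jv jm tT 0 0 0 0 0 0).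
  rewrite (partial_jet_vec jv jm tT 0 1 0 0 1 0 _ _ 0).
  rewrite (partial_jet_vec jv jm tT 0 0 1 0 0 1 _ _ 1).
  rewrite (_ : jet_dx shear_jet 0 0 0 ord_max t = fun=> 0) //.
  rewrite (_ : jet_dx (jet_mul_time density_jet) 0 0 0 ord_max t = fun=> 0) //.
  rewrite (_ : partial ord_max (fun=> 0 *: 'e_1 + 0 *: 'e_ord_max) x = 0); last first.
    exact: derive_cst.
  (* At time order 1 [jet_mul_time] leaves an extra summand, the density itself, which is the
     buoyancy; the rest is t times the density equation. *)
  rewrite /jet_dx /= /jet_mul_time /= shear_jet_heat density_jet_eq //.
  rewrite !(_ : forall r p q, shear_jet r p q.+1 t (x 0 0) (x 0 1) = 0) //.
  apply/rowP => j; rewrite !mxE /GRing.scale /= /density.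
  ring.
- rewrite dt_density // (laplacian_jet _ js tT) /advection sum_ord3.
  rewrite u0 u1 u2 !(partial_jet js tT) /jet_dx /= density_jet_eq //.
  by rewrite /GRing.scale /=; ring.
- rewrite /divergence sum_ord3.
  rewrite (_ : (fun y => velocity t y 0 0) = fun=> 0); last first.
    by apply/funext => y; have [] := velocity_coord t y.
  rewrite (_ : (fun y => velocity t y 0 1) =
      (fun x : 'rV[R]_3 => shear_jet 0 0 0 t (x 0 0) (x 0 1))); last first.
    by apply/funext => y; rewrite shear_jetE; have [] := velocity_coord t y.
  rewrite (_ : (fun y => velocity t y 0 ord_max) =
     (fun x : 'rV[R]_3 => jet_mul_time density_jet 0 0 0 t (x 0 0) (x 0 1))); last first.
    apply/funext => y; have [_ _ ->] := velocity_coord t y.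
    by rewrite /jet_mul_time (_ : 0%:R = 0) // mul0r addr0.
  rewrite (partial_jet jv tT) (partial_jet jm tT) /jet_dx /= /partial derive_cst.
  by rewrite !addr0.
Qed.

End Solution.

(** * The heat semigroup on Fourier modes *)

Section GaussianFourier.
Context {R : realType}.
Notation leb := (@lebesgue_measure R).

Definition gauss (t y : R) : R :=
  (Num.sqrt (4 * pi * t))^-1 * expR (- (y ^+ 2 / (4 * t))).

Lemma gauss_ge0 t y : 0 <= gauss t y.
Proof. by rewrite mulr_ge0 ?invr_ge0 ?expR_ge0. Qed.

Lemma gauss_normal t : 0 < t -> gauss t = normal_pdf 0 (Num.sqrt (2 * t)).
Proof.
move=> t0; have t2 : 0 <= 2 * t by rewrite mulr_ge0 // ltW.
rewrite normal_pdfE; last by rewrite gt_eqF // sqrtr_gt0 mulr_gt0.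
apply/funext => y; rewrite /gauss /normal_peak /normal_fun subr0 sqr_sqrtr //.
congr (_^-1 * expR _); first by congr Num.sqrt; rewrite -mulr_natl; ring.
by rewrite -mulr_natl mulNr; congr (- (_ / _)); ring.
Qed.

Lemma integrable_gauss t : 0 < t -> leb.-integrable setT (EFin \o gauss t).
Proof. by move=> t0; rewrite gauss_normal //; exact: integrable_normal_pdf. Qed.

Lemma Rintegral_gauss t : 0 < t -> \int[leb]_y gauss t y = 1.
Proof. by move=> t0; rewrite gauss_normal // /Rintegral integral_normal_pdf. Qed.

Lemma gauss_derive (t y : R) : 0 < t ->
  is_derive y 1 (gauss t) (- (y / (2 * t)) * gauss t y).
Proof.
move=> t0.
have h : is_derive y 1 (fun y : R => - (y ^+ 2 / (4 * t))) (- (y / (2 * t))).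
  apply: is_derive_eq; rewrite /GRing.scale /= ?mulr1 ?scaler0 ?mulr0 ?addr0 ?add0r.
  by field; rewrite gt_eqF.
have h2 := is_derive1_comp (is_derive_expR _) h.
rewrite /gauss; apply: is_derive_eq; rewrite /GRing.scale /=; ring.
Qed.

Lemma integrable_le_gauss t (C : R) (f : R -> R) : 0 < t -> continuous f ->
  (forall y, `|f y| <= C * gauss t y) -> leb.-integrable setT (EFin \o f).
Proof.
move=> t0 cf fC.
apply: (@le_integrable _ (measurableTypeR R) R leb setT measurableT (EFin \o f)
  (EFin \o (fun y => C * gauss t y))).
- by apply/measurable_EFinP; exact: continuous_measurable_fun.
- by move=> y _; rewrite /= lee_fin (le_trans (fC y)) // ler_norm.
- have := integrableZl (measurableT) C (integrable_gauss t0).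
  by exact: eq_integrable.
Qed.

(** Half of the exponent absorbs |y|: with z = y^2 / (8t), |y| <= (1 + 8t)(1 + z) <= (1 + 8t) exp z.
    This gives the dominating function for differentiation in the frequency, and the decay at
    infinity. *)
Lemma gauss_moment t : 0 < t -> exists2 C, 0 <= C &
  forall y, `|y| * gauss t y <= C * gauss (2 * t) y.
Proof.
move=> t0.
have p0 : 0 < Num.sqrt (4 * pi * t) by rewrite sqrtr_gt0 !mulr_gt0 // pi_gt0.
have q0 : 0 < Num.sqrt (4 * pi * (2 * t)) by rewrite sqrtr_gt0 !mulr_gt0 // pi_gt0.
exists ((1 + 8 * t) * (Num.sqrt (4 * pi * t))^-1 * Num.sqrt (4 * pi * (2 * t))).
  by rewrite !mulr_ge0 ?invr_ge0 ?addr_ge0 ?mulr_ge0 // ltW.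
move=> y; rewrite /gauss.
set p := Num.sqrt _ in p0 *; set q := Num.sqrt _ in q0 *.
have -> : (1 + 8 * t) / p * q * (q^-1 * expR (- (y ^+ 2 / (4 * (2 * t))))) =
   p^-1 * ((1 + 8 * t) * expR (- (y ^+ 2 / (4 * (2 * t))))).
  by field; rewrite !gt_eqF.
rewrite mulrCA; apply: ler_wpM2l; first by rewrite invr_ge0 ltW.
set z := y ^+ 2 / (4 * (2 * t)).
have -> : y ^+ 2 / (4 * t) = z + z by rewrite /z; field; rewrite gt_eqF.
rewrite opprD expRD mulrA ler_wpM2r ?expR_ge0 //.
rewrite expRN ler_pdivrMr ?expR_gt0 //.
apply: (@le_trans _ _ ((1 + 8 * t) * (1 + z))); last first.
  by rewrite ler_wpM2l ?expR_ge1Dx // addr_ge0 // mulr_ge0 // ltW.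
have -> : (1 + 8 * t) * (1 + z) = 1 + 8 * t + z + y ^+ 2.
  by rewrite /z; field; rewrite gt_eqF.
have z0 : 0 <= z by rewrite mulr_ge0 ?sqr_ge0 // invr_ge0 !mulr_ge0 // ltW.
have := sqr_ge0 (`|y| - 1); rewrite sqrrB1 real_normK ?num_real //.
by have := normr_ge0 y; nra.
Qed.

(** The fundamental theorem on [-(n+1), n+1], then n to infinity: dominated convergence for the
    integrals, the two hypotheses on [F] for the boundary values. *)
Lemma Rintegral_derive0 (F f : R -> R) : (forall x : R, is_derive x 1 F (f x)) ->
  continuous f -> leb.-integrable setT (EFin \o f) ->
  (fun n => F n.+1%:R) @ \oo --> (0 : R) ->
  (fun n => F (- n.+1%:R)) @ \oo --> (0 : R) -> \int[leb]_x f x = 0.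
Proof.
move=> dF cf intf Fp Fm.
have fT : forall x, derive1 F x = f x by move=> x; rewrite derive1E; have [_ ->] := dF x.
pose I n : set (measurableTypeR R) := [set` `[- n.+1%:R, n.+1%:R]].
pose fn n := EFin \o (f \_ (I n)).
have mI n : measurable (I n) by exact: measurable_itv.
have mf : measurable_fun setT f by exact: continuous_measurable_fun.
have H1 : (\int[leb]_x fn n x)%E @[n --> \oo] --> (\int[leb]_x (f x)%:E)%E.
  apply: (@dominated_cvg _ _ _ leb setT measurableT fn (EFin \o f) (fun x => `|f x|%:E)).
  - move=> n; apply/measurable_EFinP; apply/(measurable_restrictT f (mI n)).
    exact: measurable_funS mf.
  - move=> x _; apply: cvg_near_cst; near=> n; rewrite /fn /= patchE mem_set //.
    rewrite /I /= in_itv /= -ler_norml.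
    near: n; exists (Num.bound `|x|) => // n /= Hn.
    apply: (le_trans (ltW (archi_boundP (normr_ge0 x)))).
    by rewrite ler_nat leqW.
  - by [].
  - have := integrable_abse intf; by apply: eq_integrable.
  - move=> n x _; rewrite /fn /= lee_fin patchE; case: ifP => //.
    by rewrite normr0.
have H2 n : (\int[leb]_x fn n x = (F n.+1%:R - F (- n.+1%:R))%:E)%E.
  rewrite EFinB -(@continuous_FTC2 R f F) //.
  - by rewrite [RHS]integral_mkcond; apply: eq_integral => x _; rewrite /fn restrict_EFin.
  - by rewrite gtrN.
  - exact: continuous_subspaceT.
  - split.
    + by move=> x _; have [] := dF x.
    + by apply: cvg_at_right_filter; exact: is_derive_continuous (dF _).
    + by apply: cvg_at_left_filter; exact: is_derive_continuous (dF _).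
have H3 : (\int[leb]_x fn n x)%E @[n --> \oo] --> 0%:E.
  under eq_fun do rewrite H2.
  by apply: cvg_EFin; [exact: nearW | rewrite -[X in _ --> X]subr0; exact: cvgB].
by rewrite /Rintegral (cvg_unique _ H1 H3).
Unshelve. all: end_near. Qed.


Lemma gauss_continuous t : 0 < t -> continuous (gauss t).
Proof. by move=> t0 y; exact: is_derive_continuous (gauss_derive y t0). Qed.

Lemma phase_derive (b k y : R) :
  is_derive y 1 (fun y => cos (b - k * y)) (k * sin (b - k * y)) /\
  is_derive y 1 (fun y => sin (b - k * y)) (- k * cos (b - k * y)).
Proof.
have h : is_derive y 1 (fun y : R => b - k * y) (- k).
  by apply: is_derive_eq; rewrite /GRing.scale /=; ring.
by split; [apply: is_derive_eq (is_derive1_comp _ h) _ | apply: is_derive_eq (is_derive1_comp _ h) _]; ring.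
Qed.

Lemma phase_derive_freq (b k y : R) :
  is_derive k 1 (fun k => cos (b - k * y)) (y * sin (b - k * y)).
Proof.
have h : is_derive k 1 (fun k : R => b - k * y) (- y).
  by apply: is_derive_eq; rewrite /GRing.scale /=; ring.
by apply: is_derive_eq (is_derive1_comp _ h) _; ring.
Qed.

Lemma integrable_gauss_phase t (b k : R) : 0 < t ->
  leb.-integrable setT (EFin \o (fun y => gauss t y * cos (b - k * y))) /\
  leb.-integrable setT (EFin \o (fun y => y * gauss t y * sin (b - k * y))).
Proof.
move=> t0; split.
  apply: (@integrable_le_gauss t 1) => // y.
    have [h _] := phase_derive b k y.
    by apply: cvgM; [exact: gauss_continuous | exact: is_derive_continuous h].
  rewrite mul1r normrM (ger0_norm (gauss_ge0 _ _)) ler_piMr ?gauss_ge0 ?norm_cos_le1 //.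
have [C C0 HC] := gauss_moment t0.
apply: (@integrable_le_gauss (2 * t) C) => // [|y|y]; first by rewrite mulr_gt0.
  have [_ h] := phase_derive b k y.
  apply: cvgM; last exact: is_derive_continuous h.
  by apply: cvgM; [exact: cvg_id | exact: gauss_continuous].
apply: le_trans (HC y); rewrite normrM [X in X * _]normrM (ger0_norm (gauss_ge0 _ _)).
by rewrite ler_piMr ?mulr_ge0 ?gauss_ge0 ?norm_sin_le1.
Qed.

Lemma gauss_cvg0 t : 0 < t -> (fun n => gauss t n.+1%:R) @ \oo --> (0 : R).
Proof.
move=> t0; have [C C0 HC] := gauss_moment t0.
have t2 : 0 < 2 * t by rewrite mulr_gt0.
pose K := C * (Num.sqrt (4 * pi * (2 * t)))^-1.
have cK : (fun n => K * (n.+1%:R)^-1) @ \oo --> (0 : R).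
  by rewrite -[X in _ --> X](mulr0 K); apply: cvgMr; exact: cvg_harmonic.
apply: (squeeze_cvgr _ (cvg_cst 0) cK); near=> n.
rewrite gauss_ge0 /= ler_pdivlMr ?ltr0n // mulrC.
have := HC n.+1%:R; rewrite normr_nat => /le_trans; apply.
rewrite /K ler_wpM2l // /gauss ler_piMr ?invr_ge0 //.
by rewrite -[leRHS]expR0 ler_expR oppr_le0 divr_ge0 ?sqr_ge0 // mulr_ge0 // ltW.
Unshelve. all: end_near. Qed.

(* Integration by parts against the Gaussian, whose logarithmic derivative is
   [- y / (2 t)]. *)
Lemma gauss_by_parts t (b k : R) : 0 < t ->
  \int[leb]_y (y * gauss t y * sin (b - k * y)) =
  - (2 * t * k) * \int[leb]_y (gauss t y * cos (b - k * y)).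
Proof.
move=> t0; have [i1 i2] := integrable_gauss_phase b k t0.
pose F y := gauss t y * sin (b - k * y).
pose f y := - (2 * t)^-1 * (y * gauss t y * sin (b - k * y)) - k * (gauss t y * cos (b - k * y)).
have t2 : 2 * t != 0 by rewrite gt_eqF // mulr_gt0.
have j1 : leb.-integrable setT (EFin \o (fun y => - (2 * t)^-1 * (y * gauss t y * sin (b - k * y)))).
  by apply: eq_integrable (integrableZl measurableT (- (2 * t)^-1) i2).
have j2 : leb.-integrable setT (EFin \o (fun y => k * (gauss t y * cos (b - k * y)))).
  by apply: eq_integrable (integrableZl measurableT k i1).
have : \int[leb]_y f y = 0.
  apply: (Rintegral_derive0 (F := F)).
  - move=> y; have [_ h] := phase_derive b k y; have h' := gauss_derive y t0.
    apply: is_derive_eq; rewrite /f /GRing.scale /=; field.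
    by rewrite gt_eqF.
  - move=> y; have [h h'] := phase_derive b k y.
    apply: cvgB; apply: cvgMr.
      apply: cvgM; last exact: is_derive_continuous h'.
      by apply: cvgM; [exact: cvg_id | exact: gauss_continuous].
    by apply: cvgM; [exact: gauss_continuous | exact: is_derive_continuous h].
  - have := integrableB measurableT j1 j2; exact: eq_integrable.
  - apply: (squeeze_cvgr _ _ (gauss_cvg0 t0)); last first.
      by rewrite -[X in _ --> X]oppr0; apply: cvgN; exact: (gauss_cvg0 t0).
    near=> n; rewrite -ler_norml /F normrM ger0_norm ?gauss_ge0 //.
    by rewrite ler_piMr ?gauss_ge0 ?norm_sin_le1.
  - apply: (squeeze_cvgr _ _ (gauss_cvg0 t0)); last first.
      by rewrite -[X in _ --> X]oppr0; apply: cvgN; exact: (gauss_cvg0 t0).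
    near=> n; rewrite -ler_norml /F normrM ger0_norm ?gauss_ge0 //.
    rewrite {1}/gauss sqrrN -/(gauss t n.+1%:R).
    by rewrite ler_piMr ?gauss_ge0 ?norm_sin_le1.
rewrite /f RintegralB // !RintegralZl //.
move=> /eqP; rewrite subr_eq0 => /eqP H.
apply: (@mulfI _ (- (2 * t)^-1)); first by rewrite oppr_eq0 invr_eq0.
by rewrite H; field; rewrite gt_eqF.
Unshelve. all: end_near. Qed.

(** As a function of k the integral H satisfies H' = -2 t k H, by differentiation under the integral
    and [gauss_by_parts]. Hence exp(t k^2) H is constant, and k = 0 gives its value. *)
Lemma gauss_fourier t (b k : R) : 0 < t ->
  \int[leb]_y (gauss t y * cos (b - k * y)) = expR (- (t * k ^+ 2)) * cos b.
Proof.
move=> t0; pose H k := \int[leb]_y (gauss t y * cos (b - k * y)).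
have [C C0 HC] := gauss_moment t0.
have t2 : 0 < 2 * t by rewrite mulr_gt0.
have dH (l : R) : is_derive l 1 H (- (2 * t * l) * H l).
  have d1 (z y : R) : is_derive z 1 (fun k => gauss t y * cos (b - k * y)) (y * gauss t y * sin (b - z * y)).
    have h := phase_derive_freq b z y.
    by apply: is_derive_eq; rewrite /GRing.scale /=; ring.
  have Ik : `]l - 1, l + 1[%classic l by rewrite /= in_itv /= gtrBl ltrDl ltr01.
  have int1 z : leb.-integrable setT (EFin \o (fun y => gauss t y * cos (b - z * y))).
    by have [] := integrable_gauss_phase b z t0.
  have intG : leb.-integrable setT (EFin \o (fun y => C * gauss (2 * t) y)).
    by apply: eq_integrable (integrableZl measurableT C (integrable_gauss t2)).
  have Gub z y : `|partial1of2 (fun k y => gauss t y * cos (b - k * y)) z y| <= C * gauss (2 * t) y.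
    rewrite partial1of2E; have [_ ->] := d1 z y.
    apply: le_trans (HC y); rewrite normrM [X in X * _]normrM (ger0_norm (gauss_ge0 _ _)).
    by rewrite ler_piMr ?mulr_ge0 ?gauss_ge0 ?norm_sin_le1.
  have G0 y : 0 <= C * gauss (2 * t) y by rewrite mulr_ge0 ?gauss_ge0.
  have A := @differentiation_under_integral R _ _ leb _ setT measurableT l _ _ Ik
    (fun z _ => int1 z) (fun z y _ _ => @ex_derive _ _ _ _ _ _ _ (d1 z y)) _ G0 intG (fun z y _ _ => Gub z y).
  have B := @derivable_under_integral R _ _ leb _ setT measurableT l _ _ Ik
    (fun z _ => int1 z) (fun z y _ _ => @ex_derive _ _ _ _ _ _ _ (d1 z y)) _ G0 intG (fun z y _ _ => Gub z y).
  apply: DeriveDef; first exact: B.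
  rewrite -derive1E A /H -gauss_by_parts //; apply: eq_Rintegral => y _.
  by rewrite partial1of2E; have [_ ->] := d1 l y.
pose E k := expR (t * k ^+ 2) * H k.
have dE (z : R) : z \in `]-oo, +oo[ -> is_derive z 1 E 0.
  move=> _; have h := dH z.
  have h1 : is_derive z 1 (fun k : R => t * k ^+ 2) (2 * t * z).
    by apply: is_derive_eq; rewrite /GRing.scale /=; ring.
  have h2 := is_derive1_comp (is_derive_expR _) h1.
  by rewrite /E; apply: is_derive_eq; rewrite /GRing.scale /=; ring.
have [c _ ] := MVT_between dE (erefl : 0 \in `]-oo, +oo[) (erefl : k \in `]-oo, +oo[).
rewrite mul0r => /eqP; rewrite subr_eq0 => /eqP.
rewrite /E expr0n mulr0 expR0 mul1r -/(H k) => EH.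
rewrite expRN -[H k](@mulKf _ (expR (t * k ^+ 2))) ?gt_eqF ?expR_gt0 // EH /H; congr (_ * _).
under eq_Rintegral do rewrite mul0r subr0.
rewrite RintegralZr //; last exact: integrable_gauss.
by rewrite Rintegral_gauss // mul1r.
Qed.

End GaussianFourier.

(** * Integrals of products in separate variables *)

Section ProductIntegral.
Context d1 d2 (T1 : measurableType d1) (T2 : measurableType d2) (R : realType).
Variable m1 : {sigma_finite_measure set T1 -> \bar R}.
Variable m2 : {sigma_finite_measure set T2 -> \bar R}.
Variables (f : T1 -> R) (g : T2 -> R).
Hypothesis intf : m1.-integrable setT (EFin \o f).
Hypothesis intg : m2.-integrable setT (EFin \o g).

Lemma integrable_prod :
  (m1 \x m2)%E.-integrable setT (EFin \o (fun z => f z.1 * g z.2)).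
Proof.
have mf : measurable_fun setT f by apply/measurable_EFinP; exact: measurable_int intf.
have mg : measurable_fun setT g by apply/measurable_EFinP; exact: measurable_int intg.
have mfg : measurable_fun setT (EFin \o (fun z : T1 * T2 => f z.1 * g z.2)).
  apply/measurable_EFinP; apply: measurable_funM.
    exact: (measurableT_comp mf measurable_fst).
  exact: (measurableT_comp mg measurable_snd).
apply: (@integrable12ltyP _ _ _ _ _ m1 m2 _ mfg).2 => /=.
under eq_integral => x _.
  under eq_integral => y _ do rewrite normrM EFinM.
  rewrite integralZl //; last by have := integrable_abse intg; exact: eq_integrable.
  over.
have /integrableP[_ If] := intf; have /integrableP[_ Ig] := intg.
have Igf : (\int[m2]_y `|g y|%:E)%E \is a fin_num.
  by rewrite ge0_fin_numE // integral_ge0 // => y _; rewrite lee_fin.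
rewrite -(fineK Igf) integralZr //; last by have := integrable_abse intf; exact: eq_integrable.
by rewrite muleC lte_mul_pinfty // ?lee_fin ?fine_ge0 ?integral_ge0 // => y _; rewrite lee_fin.
Qed.

Lemma Rintegral_prod :
  \int[(m1 \x m2)%E]_z (f z.1 * g z.2) = (\int[m1]_x f x) * (\int[m2]_y g y).
Proof.
rewrite /Rintegral -(integral12_prod_meas1 integrable_prod) /fubini_F /=.
under eq_integral => x _.
  under eq_integral => y _ do rewrite EFinM.
  rewrite integralZl //.
  over.
have Igf : (\int[m2]_y (g y)%:E)%E \is a fin_num by exact: integrable_fin_num.
have Iff : (\int[m1]_y (f y)%:E)%E \is a fin_num by exact: integrable_fin_num.
by rewrite -(fineK Igf) integralZr // fineM.
Qed.

End ProductIntegral.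

(* The library declares [m1 \x m2] canonically sigma-finite only for
   subprobabilities, whence this alias. *)
Section SigmaFiniteProduct.
Context d1 d2 (T1 : measurableType d1) (T2 : measurableType d2) (R : realType).
Variable m1 : {sigma_finite_measure set T1 -> \bar R}.
Variable m2 : {sigma_finite_measure set T2 -> \bar R}.

Definition prod_measure : set (T1 * T2)%type -> \bar R := (m1 \x m2)%E.

HB.instance Definition _ := Measure.on prod_measure.

Lemma prod_measure_sigma_finite : sigma_finite setT prod_measure.
Proof.
have /sigma_finiteP[F [FT ndF Ffin]] := sigma_finiteT m1.
have /sigma_finiteP[G [GT ndG Gfin]] := sigma_finiteT m2.
exists (fun n => F n `*` G n) => [|n].
  apply/esym/seteqP; split => // -[x y] _.
  have [i _ Fx] : (\bigcup_i F i) x by rewrite -FT.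
  have [j _ Gy] : (\bigcup_i G i) y by rewrite -GT.
  exists (maxn i j) => //; split => /=.
    by have /subsetPset := ndF _ _ (leq_maxl i j); apply.
  by have /subsetPset := ndG _ _ (leq_maxr i j); apply.
have [mF F1] := Ffin n; have [mG G1] := Gfin n.
split; first exact: measurableX.
by rewrite /prod_measure product_measure1E // lte_mul_pinfty // ge0_fin_numE.
Qed.

HB.instance Definition _ :=
  Measure_isSigmaFinite.Build _ _ _ prod_measure prod_measure_sigma_finite.

End SigmaFiniteProduct.

(** * The heat semigroup: modes, linearity, contraction *)

Section Heat.
Context {R : realType}.
Notation leb := (@lebesgue_measure R).
Implicit Types (f g : 'rV[R]_3 -> R) (x : 'rV[R]_3).

Let leb2 : {sigma_finite_measure set (measurableTypeR R * measurableTypeR R)%type -> \bar R} := prod_measure leb leb.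

Lemma vec3_coord (y : R * R * R) :
  [/\ vec3 y 0 0 = y.1.1, vec3 y 0 1 = y.1.2 & vec3 y 0 ord_max = y.2].
Proof. by split; rewrite mxE. Qed.

Lemma heat_kernelE (t : R) (y : R * R * R) : 0 < t ->
  heat_kernel t (vec3 y) = gauss t y.1.1 * gauss t y.1.2 * gauss t y.2.
Proof.
move=> t0; have p0 : 0 <= 4 * pi * t :> R by rewrite !mulr_ge0 ?pi_ge0 // ltW.
have [y0 y1 y2] := vec3_coord y.
rewrite /heat_kernel /l2norm sqr_sqrtr; last by apply: sumr_ge0 => i _; exact: sqr_ge0.
rewrite sum_ord3 y0 y1 y2 powRN.
have -> : (4 * pi * t) `^ (3 / 2) = Num.sqrt (4 * pi * t) ^+ 3.
  by rewrite (_ : 3 / 2 = 2^-1 * 3%:R) ?powRrM ?powR12_sqrt // ?powR_mulrn // mulrC.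
rewrite /gauss !mulrDl !opprD !expRD !exprS expr0 !invfM invr1; ring.
Qed.

Definition heat_integrable (t : R) f x :=
  (@mu3 R).-integrable setT (EFin \o (fun y => heat_kernel t (vec3 y) * f (x - vec3 y))).

(** The kernel is a product of three one-dimensional Gaussians, and the third integrates to 1. *)
Lemma heat_tensor (t : R) (F G : R -> R) x : 0 < t ->
  leb.-integrable setT (EFin \o (fun y => gauss t y * F (x 0 0 - y))) ->
  leb.-integrable setT (EFin \o (fun y => gauss t y * G (x 0 1 - y))) ->
  heat_integrable t (fun x => F (x 0 0) * G (x 0 1)) x /\
  heat t (fun x => F (x 0 0) * G (x 0 1)) x =
    (\int[leb]_y (gauss t y * F (x 0 0 - y))) * (\int[leb]_y (gauss t y * G (x 0 1 - y))).
Proof.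
move=> t0 iF iG.
have E : (fun y => heat_kernel t (vec3 y) * (F ((x - vec3 y) 0 0) * G ((x - vec3 y) 0 1))) =
    (fun z : R * R * R => (fun w => (gauss t w.1 * F (x 0 0 - w.1)) * (gauss t w.2 * G (x 0 1 - w.2))) z.1
       * gauss t z.2).
  apply/funext => y; rewrite heat_kernelE // !mxE /=; ring.
have i12 := integrable_prod iF iG.
split; first by rewrite /heat_integrable E; exact: (integrable_prod (m1 := leb2) i12 (integrable_gauss t0)).
rewrite /heat E.
have -> := Rintegral_prod (m1 := leb2) i12 (integrable_gauss t0).
have -> := Rintegral_prod iF iG.
by rewrite Rintegral_gauss // mulr1.
Qed.

(** The phases cover sines, with c = -pi/2, and l = 0 covers functions of x_1 alone. Integrability
    is carried along for use in the linearity lemmas. *)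
Lemma heat_mode (t k b l c : R) x : 0 < t ->
  heat_integrable t (fun x => cos (k * x 0 0 + b) * cos (l * x 0 1 + c)) x /\
  heat t (fun x => cos (k * x 0 0 + b) * cos (l * x 0 1 + c)) x =
    expR (- (t * (k ^+ 2 + l ^+ 2))) * (cos (k * x 0 0 + b) * cos (l * x 0 1 + c)).
Proof.
move=> t0.
have E (m e z y : R) : cos (m * (z - y) + e) = cos (m * z + e - m * y) by congr cos; ring.
have H (m e z : R) : leb.-integrable setT (EFin \o (fun y => gauss t y * cos (m * (z - y) + e))).
  have [h _] := integrable_gauss_phase (m * z + e) m t0.
  by apply: eq_integrable h => // y _ /=; rewrite E.
have [-> ->] := heat_tensor (F := fun z => cos (k * z + b)) (G := fun z => cos (l * z + c)) t0 (H k b (x 0 0)) (H l c (x 0 1)).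
split => //.
under eq_Rintegral do rewrite E.
under [X in _ * X]eq_Rintegral do rewrite E.
by rewrite !gauss_fourier // mulrDr opprD expRD; ring.
Qed.

Lemma heatD t f g x : heat_integrable t f x -> heat_integrable t g x ->
  heat_integrable t (fun x => f x + g x) x /\
  heat t (fun x => f x + g x) x = heat t f x + heat t g x.
Proof.
move=> hf hg; have E : (fun y => heat_kernel t (vec3 y) * (f (x - vec3 y) + g (x - vec3 y))) =
   (fun y => heat_kernel t (vec3 y) * f (x - vec3 y) + heat_kernel t (vec3 y) * g (x - vec3 y)).
  by apply/funext => y; rewrite mulrDr.
split; last by rewrite /heat E RintegralD.
by rewrite /heat_integrable E; have := integrableD measurableT hf hg; exact: eq_integrable.
Qed.

Lemma heatZ t (c : R) f x : heat_integrable t f x ->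
  heat_integrable t (fun x => c * f x) x /\
  heat t (fun x => c * f x) x = c * heat t f x.
Proof.
move=> hf; have E : (fun y => heat_kernel t (vec3 y) * (c * f (x - vec3 y))) =
   (fun y => c * (heat_kernel t (vec3 y) * f (x - vec3 y))).
  by apply/funext => y; rewrite mulrCA.
split; last by rewrite /heat E RintegralZl.
by rewrite /heat_integrable E; have := integrableZl measurableT c hf; exact: eq_integrable.
Qed.

Lemma heat0 t x : heat_integrable t (fun=> 0) x /\ heat t (fun=> 0) x = 0.
Proof.
have E : (fun y => heat_kernel t (vec3 y) * (0 : R)) = cst 0.
  by apply/funext => y; rewrite mulr0.
split; last by rewrite /heat E Rintegral_cst // mul0r.
by rewrite /heat_integrable E; apply: eq_integrable (integrable0 _ _).
Qed.

Lemma heat_sum t (I : Type) (s : seq I) (f : I -> 'rV[R]_3 -> R) x :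
  (forall i, heat_integrable t (f i) x) ->
  heat_integrable t (fun x => \sum_(i <- s) f i x) x /\
  heat t (fun x => \sum_(i <- s) f i x) x = \sum_(i <- s) heat t (f i) x.
Proof.
move=> hf; elim: s => [|i s [IH1 IH2]].
  rewrite big_nil (_ : (fun _ => _) = fun=> 0); first exact: heat0.
  by apply/funext => y; rewrite big_nil.
rewrite big_cons (_ : (fun x0 => _) = (fun x => f i x + \sum_(j <- s) f j x)).
  by have [h1 h2] := heatD (hf i) IH1; rewrite h2 IH2.
by apply/funext => y; rewrite big_cons.
Qed.

(** The kernel is positive with mass 1. This controls the error part of the density, which is not a
    finite sum of modes. *)
Lemma heat_le t f (eta : R) x : 0 < t ->
  measurable_fun setT (fun y : R * R * R => f (x - vec3 y)) ->
  (forall x, `|f x| <= eta) ->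
  heat_integrable t f x /\ `|heat t f x| <= eta.
Proof.
move=> t0 mf fe.
have eta0 : 0 <= eta by apply: le_trans (fe 0).
have E : (fun y => heat_kernel t (vec3 y)) =
    (fun z : R * R * R => (fun w => gauss t w.1 * gauss t w.2) z.1 * gauss t z.2).
  by apply/funext => y; rewrite heat_kernelE.
have i1 := integrable_gauss t0.
have iK : (@mu3 R).-integrable setT (EFin \o (fun y => heat_kernel t (vec3 y))).
  by rewrite E; exact: (integrable_prod (m1 := leb2) (integrable_prod i1 i1) i1).
have K1 : \int[@mu3 R]_y (heat_kernel t (vec3 y)) = 1.
  rewrite E; have -> := Rintegral_prod (m1 := leb2) (integrable_prod i1 i1) i1.
  by have -> := Rintegral_prod i1 i1; rewrite Rintegral_gauss // !mulr1.
have K0 y : 0 <= heat_kernel t (vec3 y).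
  by rewrite heat_kernelE // !mulr_ge0 ?gauss_ge0.
have mK : measurable_fun setT (fun y : R * R * R => heat_kernel t (vec3 y)).
  by apply/measurable_EFinP; exact: measurable_int iK.
have ieK : (@mu3 R).-integrable setT (EFin \o (fun y => eta * heat_kernel t (vec3 y))).
  by have := integrableZl measurableT eta iK; exact: eq_integrable.
have le y : `|heat_kernel t (vec3 y) * f (x - vec3 y)| <= eta * heat_kernel t (vec3 y).
  by rewrite normrM (ger0_norm (K0 y)) mulrC ler_wpM2r.
have h1 : heat_integrable t f x.
  apply: (@le_integrable _ _ R (@mu3 R) setT measurableT _
    (EFin \o (fun y => eta * heat_kernel t (vec3 y)))) ieK.
    by apply/measurable_EFinP; exact: measurable_funM.
  by move=> y _; rewrite /= lee_fin (le_trans (le y)) // ler_norm.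
split => //; rewrite /heat (le_trans (le_normr_Rintegral _ h1)) //.
have <- : \int[@mu3 R]_y (eta * heat_kernel t (vec3 y)) = eta.
  by rewrite RintegralZl // K1 mulr1.
apply: le_Rintegral => //.
by have := integrable_abse h1; exact: eq_integrable.
Qed.

End Heat.

(** * Besov norms *)

Section BesovBounds.
Context {R : realType}.
Notation leb := (@lebesgue_measure R).
Implicit Types (f : 'rV[R]_3 -> R) (x : 'rV[R]_3).

Lemma mu3_box (A : set (measurableTypeR R)) : measurable A -> (0 < leb A)%E ->
  measurable (([set: measurableTypeR R] `*` A) `*` [set: measurableTypeR R]) /\
  (0 < (@mu3 R) ((([set: measurableTypeR R] `*` A) `*` [set: measurableTypeR R])))%E.
Proof.
move=> mA A0.
have lT : (0 < leb [set: measurableTypeR R])%E by rewrite -set_itvNyy lebesgue_measure_itv /= ltry.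
have m1 : measurable ([set: measurableTypeR R] `*` A) by exact: measurableX.
split; first exact: measurableX.
have A1 : (0 < (leb \x leb)%E ([set: measurableTypeR R] `*` A))%E.
  by rewrite product_measure1E // mule_gt0.
by rewrite /mu3 product_measure1E // mule_gt0.
Qed.

(** An essential supremum ignores null sets, so a lower bound is required on a slab of positive
    measure; an essential bound below c would put the slab inside a null set. *)
Lemma Linfty_ge f (c : R) (A : set (measurableTypeR R)) :
  measurable A -> (0 < leb A)%E ->
  (forall x, A (x 0 1) -> c <= `|f x|) -> (c%:E <= Linfty f)%E.
Proof.
move=> mA A0 fc; have [mB B0] := mu3_box mA A0.
set Bx := (_ `*` _) in mB B0.
have T0 : (0 < (@mu3 R) setT)%E.
  by apply: (lt_le_trans B0); apply: le_measure; rewrite ?inE //; exact: measurableT.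
rewrite /Linfty unlock T0; apply: le_ereal_inf_tmp => y /= [N [mN N0 sub]].
rewrite leNgt; apply/negP => yc.
have : (@mu3 R Bx <= @mu3 R N)%E.
  apply: le_measure; rewrite ?inE // => z [[_ Az] _]; apply: sub => /= fy.
  have := le_lt_trans fy yc; rewrite lte_fin ltNge => /negP; apply.
  by apply: fc; rewrite mxE.
have -> : @mu3 R N = 0%E by exact: N0.
by rewrite leNgt B0.
Qed.

Lemma Linfty_le f (c : R) : (forall x, `|f x| <= c) -> (Linfty f <= c%:E)%E.
Proof.
move=> fc; rewrite /Linfty unlock; case: ifPn => _; last first.
  by rewrite lee_fin (le_trans _ (fc 0)).
apply: ereal_inf_lbound => /=; apply: aeW => z /=.
by rewrite lee_fin fc.
Qed.

Lemma besov_le s f (C : R) :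
  (forall t x, 0 < t -> t `^ (s / 2) * `|heat t f x| <= C) ->
  (besov s f <= C%:E)%E.
Proof.
move=> H; apply: ge_ereal_sup => _ /= [t t0 <-].
have p0 : 0 < t `^ (s / 2) by rewrite powR_gt0.
apply: (@le_trans _ _ ((t `^ (s / 2))%:E * (C / t `^ (s / 2))%:E)%E).
  rewrite lee_pmul2l ?lte_fin //; apply: Linfty_le => x.
  by rewrite ler_pdivlMr // mulrC H.
by rewrite -EFinM lee_fin mulrC divfK // gt_eqF.
Qed.

Lemma besov_vec_le s (v : 'rV[R]_3 -> 'rV[R]_3) (C : R) :
  (forall t x, 0 < t -> t `^ (s / 2) * l2norm (heat_vec t v x) <= C) ->
  (besov_vec s v <= C%:E)%E.
Proof.
move=> H; apply: ge_ereal_sup => _ /= [t t0 <-].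
have p0 : 0 < t `^ (s / 2) by rewrite powR_gt0.
apply: (@le_trans _ _ ((t `^ (s / 2))%:E * (C / t `^ (s / 2))%:E)%E).
  rewrite lee_pmul2l ?lte_fin //; apply: Linfty_le => x.
  by rewrite ger0_norm ?sqrtr_ge0 // ler_pdivlMr // mulrC H.
by rewrite -EFinM lee_fin mulrC divfK // gt_eqF.
Qed.

Lemma besov_ge s f (c : R) (A : set (measurableTypeR R)) :
  measurable A -> (0 < leb A)%E ->
  (forall x, A (x 0 1) -> c <= `|heat 1 f x|) -> (c%:E <= besov s f)%E.
Proof.
move=> mA A0 H; apply: le_ereal_sup_tmp; exists ((1 `^ (s / 2))%:E * Linfty (heat 1 f))%E.
  by exists 1 => //=.
by rewrite powR1 mul1e; exact: Linfty_ge H.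
Qed.

Lemma heat_modes t (D : seq int) (w : int -> R) (l b : R) x : 0 < t ->
  (forall d, 0 <= w d) ->
  heat t (fun x => \sum_(d <- D) w d * (cos (d%:~R * x 0 0 + 0) * cos (l * x 0 1 + b))) x =
    \sum_(d <- D) w d * (expR (- (t * (d%:~R ^+ 2 + l ^+ 2))) *
       (cos (d%:~R * x 0 0 + 0) * cos (l * x 0 1 + b))).
Proof.
move=> t0 w0.
have hm d := heat_mode d%:~R 0 l b x t0.
have hz d := heatZ (w d) (hm d).1.
have [_ ->] := heat_sum D (fun d => (hz d).1).
by apply: eq_bigr => d _; rewrite (hz d).2 (hm d).2.
Qed.

Lemma heat_modes_le t (D : seq int) (w : int -> R) (l b : R) x : 0 < t ->
  (forall d, 0 <= w d) ->
  `|heat t (fun x => \sum_(d <- D) w d * (cos (d%:~R * x 0 0 + 0) * cos (l * x 0 1 + b))) x|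
   <= \sum_(d <- D) w d * expR (- (t * d%:~R ^+ 2)).
Proof.
move=> t0 w0; rewrite heat_modes // (le_trans (ler_norm_sum _ _ _)) //.
apply: ler_sum => d _; rewrite normrM (ger0_norm (w0 d)) ler_wpM2l // normrM.
rewrite (ger0_norm (expR_ge0 _)) -[leRHS]mulr1; apply: ler_pM; rewrite ?expR_ge0 //.
  by rewrite ler_expR lerN2 mulrDr lerDl mulr_ge0 ?sqr_ge0 // ltW.
by rewrite normrM mulr_ile1 ?norm_cos_le1.
Qed.

(* [x exp(-x^2)] is bounded by an increment of the bounded increasing function
   [4x/(1+x)] between [x] and [2x], so the sum over a dyadic scale telescopes. *)
Lemma dyadic_sum_le (z : R) n : 0 <= z ->
  \sum_(j < n) (z * 2 ^+ j) * expR (- (z * 2 ^+ j) ^+ 2) <= 4.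
Proof.
move=> z0; pose h (x : R) := 4 * x / (1 + x).
have step (x : R) : 0 <= x -> x * expR (- x ^+ 2) <= h (2 * x) - h x.
  move=> x0; have x1 : 0 < 1 + x by lra.
  have x2 : 0 < 1 + 2 * x by lra.
  have -> : h (2 * x) - h x = x * (4 / ((1 + 2 * x) * (1 + x))).
    by rewrite /h; field; rewrite !gt_eqF.
  rewrite ler_wpM2l // expRN ler_pdivlMr ?mulr_gt0 // mulrC ler_pdivrMr ?expR_gt0 //.
  apply: (@le_trans _ _ (4 * (1 + x ^+ 2))); last by rewrite ler_wpM2l // expR_ge1Dx.
  nra.
apply: (@le_trans _ _ (h (z * 2 ^+ n) - h z)).
  elim: n => [|n IH]; first by rewrite big_ord0 expr0 mulr1 subrr.
  rewrite big_ord_recr /= (le_trans (lerD IH (step _ _))) ?mulr_ge0 ?exprn_ge0 //.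
  by rewrite exprS mulrCA addrC addrA subrK.
have y0 : 0 <= z * 2 ^+ n by rewrite mulr_ge0 // exprn_ge0.
have h0 : 0 <= h z by rewrite divr_ge0 // ?mulr_ge0 // addr_ge0.
have : h (z * 2 ^+ n) <= 4 by rewrite ler_pdivrMr ?ltr_wpDr // ; lra.
lra.
Qed.

Definition modes (N n : nat) : seq int :=
  [seq (N * 2 ^ j)%:Z | j <- iota 0 n] ++ [seq - (N * 2 ^ j)%:Z | j <- iota 0 n].

Lemma modes_sym N n : perm_eq (map -%R (modes N n)) (modes N n).
Proof.
rewrite /modes map_cat -!map_comp /= perm_catC.
rewrite (@eq_map _ _ (-%R \o (fun j => - (N * 2 ^ j)%:Z)) (fun j => (N * 2 ^ j)%:Z)) //.
by move=> j /=; rewrite opprK.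
Qed.

Lemma size_modes N n : size (modes N n) = (2 * n)%N.
Proof. by rewrite size_cat !size_map size_iota mul2n addnn. Qed.

Lemma modesP N n d : d \in modes N n ->
  exists2 j, (j < n)%N & `|d| = (N * 2 ^ j)%:Z.
Proof.
rewrite mem_cat => /orP[] /mapP[j]; rewrite mem_iota /= add0n => jn ->; exists j => //.
by rewrite normrN.
Qed.

Lemma sum_modes N n (F : int -> R) : (forall d, F (- d) = F d) ->
  \sum_(d <- modes N n) F d = 2 * \sum_(j < n) F (N * 2 ^ j)%:Z.
Proof.
move=> FN; rewrite /modes big_cat !big_map mulr_natl mulr2n.
rewrite -(big_mkord xpredT (fun j => F (N * 2 ^ j)%:Z)) /index_iota subn0.
by congr (_ + _); apply: eq_bigr => j _; rewrite FN.
Qed.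

(** The two signs compensate the half in [amplitude]; with z = sqrt(t) N the expression is a times
    the sum in [dyadic_sum_le]. *)
Lemma modes_besov_le (a : R) N n t : 0 <= a -> 0 < t ->
  t `^ (1 / 2) * \sum_(d <- modes N n) amplitude a d * expR (- (t * d%:~R ^+ 2)) <= 4 * a.
Proof.
move=> a0 t0; rewrite sum_modes; last first.
  by move=> d; rewrite amplitudeN mulrNz sqrrN.
have st : Num.sqrt t ^+ 2 = t by rewrite sqr_sqrtr // ltW.
rewrite div1r powR12_sqrt ?(ltW t0) // !mulr_sumr.
apply: (@le_trans _ _ (a * \sum_(j < n) (Num.sqrt t * N%:R * 2 ^+ j) *
    expR (- (Num.sqrt t * N%:R * 2 ^+ j) ^+ 2))); last first.
  by rewrite mulrC ler_wpM2r // dyadic_sum_le // mulr_ge0.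
rewrite mulr_sumr; apply: ler_sum => j _.
rewrite /amplitude (ger0_norm (_ : 0 <= _)) ?ler0z // -pmulrn natrM natrX.
have -> : t * (N%:R * 2 ^+ j) ^+ 2 = (Num.sqrt t * N%:R * 2 ^+ j) ^+ 2.
  by rewrite -[in LHS]st; ring.
by set e := expR _; rewrite le_eqVlt; apply/orP; left; apply/eqP; field.
Qed.

End BesovBounds.

(** * Norm inflation *)

Section TwoWaveCoefficients.
Context {R : realType}.
Variable a : R.
Implicit Types d : int.
Local Notation sq d := ((d%:~R : R) ^+ 2).

Lemma freq1 d : freq [:: d] = d.
Proof. by rewrite /freq big_seq1. Qed.

Lemma freq2 d d' : freq [:: d; d'] = d + d'.
Proof. by rewrite /freq big_cons big_seq1. Qed.

Lemma coef1E d (t : R) : 0 <= t ->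
  coef a [:: d] t = amplitude a d * expR (- (sq d + 1) * t).
Proof.
move=> t0; apply: (@duhamel_unique _ (coef a [:: d])
  (fun t => amplitude a d * expR (- (sq d + 1) * t)) (coef_source a [:: d])
  (decay [:: d]) _ _ _ t t0) => [s s0|s s0|].
- exact: is_derive_coef.
- have h := is_derive_expRM (- (sq d + 1)) s.
  apply: is_derive_eq; rewrite /coef_source /decay freq1 (_ : coef a [::] s = 0) //.
  by rewrite /GRing.scale /=; ring.
- by rewrite coef_cons0 mulr0 expR0 mulr1.
Qed.

(** The word has total frequency 0, hence decay rate only 1, while its source decays at rate 2 d^2 +
    1. The prefactor equals a^2 / 8 whatever the size of d. *)
Lemma coef2_resonant d (t : R) : d != 0 -> 0 <= t ->
  coef a [:: - d; d] t =
  amplitude a d ^+ 2 / (2 * sq d) * (expR (- 1 * t) - expR (- (2 * sq d + 1) * t)).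
Proof.
move=> d0 t0; have q0 : (d%:~R : R) != 0 by rewrite intr_eq0.
apply: (@duhamel_unique _ (coef a [:: - d; d])
  (fun t => amplitude a d ^+ 2 / (2 * sq d) * (expR (- 1 * t) - expR (- (2 * sq d + 1) * t)))
  (coef_source a [:: - d; d]) (decay [:: - d; d]) _ _ _ t t0) => [s s0|s s0|].
- exact: is_derive_coef.
- have h := is_derive_expRM (- 1 : R) s; have h' := is_derive_expRM (- (2 * sq d + 1)) s.
  apply: is_derive_eq; rewrite /coef_source /decay freq2 addNr coef1E // amplitudeN mulrNz sqrrN.
  have -> : expR (- (2 * sq d + 1) * s) = expR (- sq d * s) * expR (- (sq d + 1) * s).
    by rewrite -expRD; congr expR; ring.
  rewrite /GRing.scale /= ?mulr0z expr0n /=. by field.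
- by rewrite coef_cons0 !mulr0 subrr mulr0.
Qed.

(** For non-resonant pairs both the source and the word itself decay at rate at least q, and
    Duhamel's integral of exp(-q t) against itself is t exp(-q t). *)
Lemma coef2_le d d' (B q t : R) : 0 <= a -> 0 <= B ->
  amplitude a d <= B -> amplitude a d' <= B -> q <= sq d' -> q <= decay [:: d; d'] ->
  0 <= t -> `|coef a [:: d; d'] t| <= B ^+ 2 * (t * expR (- q * t)).
Proof.
move=> a0 B0 dB dB' qd' qw t0.
apply: (@duhamel_bound _ (coef a [:: d; d']) (fun t => B ^+ 2 * (t * expR (- q * t)))
  (fun t => B ^+ 2 * (expR (- q * t) + t * (- q * expR (- q * t))))
  (coef_source a [:: d; d']) (decay [:: d; d']) _ _ _ _ t t0) => [s s0|s s0|s s0|].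
- exact: is_derive_coef.
- have h := is_derive_expRM (- q) s.
  by apply: is_derive_eq; rewrite /GRing.scale /=; ring.
- rewrite /coef_source coef1E //.
  apply: (@le_trans _ _ (B ^+ 2 * expR (- q * s))); last first.
    have -> : B ^+ 2 * (expR (- q * s) + s * (- q * expR (- q * s))) +
      decay [:: d; d'] * (B ^+ 2 * (s * expR (- q * s))) =
      B ^+ 2 * expR (- q * s) + (decay [:: d; d'] - q) * (B ^+ 2 * (s * expR (- q * s))).
      by ring.
    by rewrite lerDl mulr_ge0 ?subr_ge0 // mulr_ge0 ?sqr_ge0 // mulr_ge0 ?expR_ge0.
  have E1 : expR (- sq d * s) <= 1.
    by rewrite -expR0 ler_expR mulNr oppr_le0 mulr_ge0 ?sqr_ge0.
  have E2 : expR (- (sq d' + 1) * s) <= expR (- q * s).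
    by rewrite ler_expR ler_wpM2r // lerN2 (le_trans qd') // lerDl.
  have am (e : int) := amplitude_ge0 a0 e.
  rewrite ger0_norm; last by rewrite !mulr_ge0 ?am ?expR_ge0.
  rewrite mulrACA expr2; apply: ler_pM; rewrite ?mulr_ge0 ?am ?expR_ge0 //.
    by apply: ler_pM; rewrite ?am.
  by rewrite -[leRHS]mul1r; apply: ler_pM; rewrite ?expR_ge0.
- by rewrite coef_cons0 normr0 !mul0r mulr0.
Qed.

End TwoWaveCoefficients.

(** * The resonant mode and the error around it *)

Section Inflation.
Context {R : realType}.
Variables (a : R) (N n : nat).
Hypothesis a0 : 0 < a.
Hypothesis N0 : (0 < N)%N.
Hypothesis naN : n%:R * a <= 4^-1 * N%:R.
Let D := modes N n.
(** [M] bounds the frequencies, [B] the amplitudes, and [th] the ratios amplitude / d^2 = a /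
    (2|d|), because |d| >= N. *)
Let M : R := N%:R * 2 ^+ n.
Let B : R := a * M / 2.
Let th : R := a / (2 * N%:R).
Variable T : R.
Hypothesis T0 : 0 < T.
Local Notation sq d := ((d%:~R : R) ^+ 2).

Let NR : 0 < N%:R :> R. Proof. by rewrite ltr0n. Qed.

Let th0 : 0 < th. Proof. by rewrite divr_gt0 // mulr_gt0. Qed.

Let B0 : 0 <= B.
Proof. by rewrite divr_ge0 // !mulr_ge0 ?exprn_ge0 // ltW. Qed.

Let normd d : d \in D -> N%:R <= `|d%:~R : R| <= M.
Proof.
move=> /modesP[j jn dj]; rewrite -intr_norm dj -pmulrn natrM natrX.
apply/andP; split; first by rewrite ler_peMr ?(ltW NR) // exprn_ege1 // ler1n.
by rewrite /M ler_pM2l // ler_weXn2l ?ler1n // ltnW.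
Qed.

Let DB d : d \in D -> amplitude a d <= B.
Proof.
by move=> /normd/andP[_ dM]; rewrite /amplitude /B ler_pM2r ?invr_gt0 // ler_pM2l.
Qed.

Let Dth d : d \in D -> amplitude a d <= th * sq d.
Proof.
move=> /normd/andP[Nd _]; rewrite /amplitude /th -real_normK ?num_real //.
rewrite -mulrA mulrAC -subr_ge0.
have -> : a * `|d%:~R| ^+ 2 / (2 * N%:R) - a * (`|d%:~R| / 2) =
   a * `|d%:~R| / (2 * N%:R) * (`|d%:~R : R| - N%:R) by field; rewrite gt_eqF.
by rewrite mulr_ge0 ?subr_ge0 // divr_ge0 // mulr_ge0 // ltW.
Qed.

Let D0 d : d \in D -> d != 0.
Proof.
move=> /normd/andP[Nd _]; apply: contraTneq Nd => ->.
by rewrite normr0 -ltNge.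
Qed.

Let DM d : d \in D -> `|d%:~R| <= M.
Proof. by move=> /normd/andP[]. Qed.

Let Dsize : (size D)%:R = 2 * n%:R :> R.
Proof. by rewrite size_modes natrM. Qed.

Let D4 : (size D)%:R * th <= 4^-1.
Proof.
rewrite Dsize /th (_ : _ * _ = n%:R * a / N%:R); first by rewrite ler_pdivrMr.
by field; rewrite gt_eqF.
Qed.

Let Dsym := modes_sym N n.
Let a0' := ltW a0.

Let rho := density a D.

Lemma inflation_solution : boussinesq_solution T (velocity a D) rho.
Proof. exact: (velocity_solution a0' th0 DB Dth D0 DM D4 Dsym T0). Qed.

Let tT (t : R) : 0 <= t -> t <= T -> t \in `[0, T].
Proof. by move=> h1 h2; rewrite in_itv /= h1. Qed.

Lemma density_cvg t x y : 0 <= t -> t <= T ->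
  series (fun m => block a D m 0 0 0 t x y) @ \oo --> density_jet a D 0 0 0 t x y.
Proof.
move=> h1 h2; apply: (jet_sum_cvg (T := T)) => //; last exact: tT.
exact: (block_geometric a0' th0 DB Dth D0 DM D4 T).
Qed.

Lemma density0E x : rho 0 x =
  \sum_(d <- D) amplitude a d * (cos (d%:~R * x 0 0 + 0) * cos (1 * x 0 1 + - (pi / 2))).
Proof.
have h := @density_cvg 0 (x 0 0) (x 0 1) (lexx _) (ltW T0).
rewrite /rho /density -(cvg_lim _ h) //.
set b := \sum_(d <- D) _.
(* At time 0 only block 0 is present, as the coefficients of longer words start from 0. *)
suff E k : series (fun m => block a D m 0 0 0 0 (x 0 0) (x 0 1)) k.+1 = b.
  apply: cvg_lim => //; rewrite -cvg_shiftS.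
  by under eq_fun do rewrite E; exact: cvg_cst.
elim: k => [|k IH].
  rewrite /series /= big_nat1; have [-> _ _ _] := block_termE a D 0 0 (x 0 0) (x 0 1).
  rewrite /= big_map; apply: eq_bigr => d _.
  rewrite /block_term coef_cons0 freq1 (_ : 0%:R * _ = 0) ?mul0r // subr0.
  by rewrite addr0 mul1r cosBpihalf mulrA.
rewrite /series /= in IH *; rewrite big_nat_recr //= IH.
rewrite [X in _ + X](_ : _ = 0) ?addr0 //.
have [-> _ _ _] := block_termE a D k.+1 0 (x 0 0) (x 0 1).
rewrite /= big_allpairs_dep /=; apply: big1_seq => d _; apply: big1_seq => w /andP[_ wD].
have [sw _] := mem_words wD; case: w sw {wD} => // e w _.
by rewrite /block_term coef_cons0 !mul0r.
Qed.

Lemma besov_density0 : (besov 1 (rho 0) <= (4 * a)%:E)%E.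
Proof.
apply: besov_le => t x t0; apply: le_trans (modes_besov_le N n a0' t0).
rewrite ler_wpM2l ?powR_ge0 // (_ : rho 0 = fun x => \sum_(d <- D) amplitude a d *
   (cos (d%:~R * x 0 0 + 0) * cos (1 * x 0 1 + - (pi / 2)))).
  by apply: heat_modes_le => // d; exact: amplitude_ge0.
by apply/funext => z; exact: density0E.
Qed.

Lemma besov_velocity0 : (besov_vec 1 (velocity a D 0) <= (4 * a)%:E)%E.
Proof.
apply: besov_vec_le => t x t0; apply: le_trans (modes_besov_le N n a0' t0).
rewrite ler_wpM2l ?powR_ge0 //.
have hv i : heat_vec t (velocity a D 0) x 0 i = heat t (fun y => velocity a D 0 y 0 i) x.
  by rewrite mxE.
rewrite /l2norm sum_ord3 !hv.
have vE y := velocity_coord a D 0 y.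
rewrite (_ : (fun y => velocity a D 0 y 0 0) = fun=> 0); last first.
  by apply/funext => y; have [] := vE y.
rewrite (_ : (fun y => velocity a D 0 y 0 ord_max) = fun=> 0); last first.
  by apply/funext => y; have [_ _ ->] := vE y; rewrite mul0r.
rewrite (heat0 t x).2 expr0n addr0 add0r sqrtr_sqr.
rewrite (_ : (fun y => velocity a D 0 y 0 1) = fun x => \sum_(d <- D) amplitude a d *
   (cos (d%:~R * x 0 0 + 0) * cos (0 * x 0 1 + 0))).
  by apply: heat_modes_le => // d; exact: amplitude_ge0.
apply/funext => y; have [_ -> _] := vE y; apply: eq_bigr => d _.
by rewrite mulr0 expR0 mul0r !addr0 cos0 !mulr1.
Qed.


Let normd_sq d : d \in D -> N%:R ^+ 2 <= sq d.
Proof.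
move=> /normd/andP[Nd _]; rewrite -[leRHS]real_normK ?num_real //.
by apply: lerXn2r; rewrite ?nnegrE // ltW.
Qed.

Let dvd_modes d : d \in D -> (N%:Z %| d)%Z.
Proof.
by move=> /modesP[j _]; rewrite -abszE dvdzE => -[->]; rewrite dvdn_mulr.
Qed.

(** All frequencies are multiples of N, so a nonzero sum of two of them is at least N in absolute
    value. *)
Lemma decay2_ge d d' : d \in D -> d' \in D -> d + d' != 0 ->
  N%:R ^+ 2 <= decay [:: d; d'] :> R.
Proof.
move=> dD dD' dd; rewrite /decay freq2.
have Ndd : (N%:Z %| d + d')%Z by apply: rpredD; exact: dvd_modes.
have le : (N <= `|(d + d')%R|)%N.
  by apply: dvdn_leq; rewrite ?absz_gt0 //; move: Ndd; rewrite dvdzE.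
rewrite (@le_trans _ _ (sq (d + d'))) ?lerDl //.
rewrite -[leRHS]real_normK ?num_real //; apply: lerXn2r; rewrite ?nnegrE ?ler0n //.
by rewrite -intr_norm -abszE -pmulrn ler_nat.
Qed.

Let E0 : R := expR (- (N%:R ^+ 2) * T).

Lemma coef1_modes_le d : d \in D -> `|coef a [:: d] T| <= B * E0.
Proof.
move=> dD; rewrite coef1E ?(ltW T0) // ger0_norm; last first.
  by rewrite mulr_ge0 ?expR_ge0 // amplitude_ge0.
apply: ler_pM; rewrite ?expR_ge0 ?amplitude_ge0 ?DB //.
by rewrite ler_expR ler_pM2r // lerN2 (le_trans (normd_sq dD)) // lerDl.
Qed.

Lemma block0_le x y : `|block a D 0 0 0 0 T x y| <= (2 * n%:R) * (B * E0).
Proof.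
apply: (le_trans (@block_le_words _ a D (B * E0) 0 0 0 0 T x y _)).
  move=> w; rewrite /= => /mapP[d dD ->].
  by rewrite expr0 mulr1 jcoef0 oppr0 mul0r expR0 mul1r coef1_modes_le.
by rewrite expr1 Dsize.
Qed.

Definition resonant : R := \sum_(w <- words D 1 | freq w == 0) coef a w T.

Let Q : R := B ^+ 2 * (T * E0).
Let Q0 : 0 <= Q.
Proof. by rewrite mulr_ge0 ?sqr_ge0 // mulr_ge0 ?expR_ge0 // ltW. Qed.

Lemma block1_le x y :
  `|block a D 1 0 0 0 T x y + resonant * cos y| <= (2 * n%:R) ^+ 2 * Q.
Proof.
have [-> _ _ _] := block_termE a D 1 T x y.
rewrite (bigID (fun w => freq w == 0)) /= addrAC.
(* Block 1 carries sin(y - pi/2) = -cos y, hence the plus sign in the statement. *)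
have -> : \sum_(w <- words D 1 | freq w == 0) block_term 1 (coef a w T) (freq w)%:~R x y
    = - (resonant * cos y).
  rewrite /resonant mulr_suml -sumrN; apply: eq_bigr => w /eqP ->.
  by rewrite /block_term mul0r cos0 mulr1 mul1r sinBpihalf mulrN.
rewrite addNr add0r (le_trans (ler_norm_sum _ _ _)) //.
have -> : (2 * n%:R) ^+ 2 * Q = \sum_(w <- words D 1) Q.
  by rewrite big_const_seq count_predT iter_addr_0 size_words -[RHS]mulr_natl natrX Dsize.
rewrite big_mkcond big_seq [leRHS]big_seq; apply: ler_sum => w wD.
case: ifP => // f0; have [sw aw] := @mem_words D 1 w wD.
rewrite /block_term normrM -[leRHS]mulr1; apply: ler_pM => //; last exact: norm_sin_le1.
rewrite normrM -[leRHS]mulr1; apply: ler_pM => //; last exact: norm_cos_le1.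
case: w sw aw f0 {wD} => [//|d [//|d' [|//]]] _ /= /and3P[dD dD' _].
rewrite freq2 => dd.
by apply: coef2_le; rewrite ?DB ?normd_sq ?decay2_ge // ltW.
Qed.

(** From three letters on the bound B th^m suffices: B grows like N and th^2 decays like N^-2, so
    the tail is of order 1/N. Blocks 0 and 1, with B and B th, would not be small this way. *)
Lemma block_tail_le x y : `|density_jet a D 0 0 0 T x y - block a D 0 0 0 0 T x y
   - block a D 1 0 0 0 T x y| <= 2 * (2 * n%:R * B * (2 * n%:R * th) ^+ 2).
Proof.
pose u m := block a D m.+2 0 0 0 T x y.
have nth : 0 <= 2 * n%:R * th by rewrite !mulr_ge0 // ltW.
have nth2 : 2 * n%:R * th <= 2^-1 by rewrite -Dsize (le_trans D4) //; lra.
have [|_ H] := @geometric_dominated _ u (2 * n%:R * B * (2 * n%:R * th) ^+ 2).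
  move=> m; apply: (@le_trans _ _ ((2 * n%:R) ^+ m.+3 * (B * th ^+ m.+2))).
    rewrite -Dsize; apply: block_le_words => w /mem_words [sw wD].
    rewrite expr0 mulr1 jcoef0 oppr0 mul0r expR0 mul1r.
    exact: (coef_le a0' th0 DB Dth D0 sw wD (ltW T0)).
  rewrite (_ : _ * _ = 2 * n%:R * B * (2 * n%:R * th) ^+ 2 * (2 * n%:R * th) ^+ m).
    rewrite ler_wpM2l //; first by rewrite !mulr_ge0 ?exprn_ge0.
    by apply: lerXn2r; rewrite ?nnegrE.
  by rewrite [X in X * _ = _]exprS -mulrA -[RHS]mulrA -exprD add2n [in RHS]exprMn; ring.
suff -> : density_jet a D 0 0 0 T x y - block a D 0 0 0 0 T x y
   - block a D 1 0 0 0 T x y = limn (series u) by [].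
have h := @density_cvg T x y (ltW T0) (lexx _).
apply/esym/cvg_lim => //.
rewrite (_ : series u = fun k => series (fun m => block a D m 0 0 0 T x y) k.+2
   - block a D 0 0 0 0 T x y - block a D 1 0 0 0 T x y).
  apply: cvgB; last exact: cvg_cst.
  apply: cvgB; last exact: cvg_cst.
  pose S := series (fun m => block a D m 0 0 0 T x y).
  by rewrite (cvg_shiftS (fun k => S k.+1)) cvg_shiftS.
apply/funext; elim => [|k IH].
  rewrite /series /=; by rewrite big_geq // big_nat_recr //= big_nat1; ring.
by rewrite /series /= in IH *; rewrite big_nat_recr //= IH [in RHS]big_nat_recr //= /u; ring.
Qed.

Definition inflation_error : R := (2 * n%:R) * (B * E0) + (2 * n%:R) ^+ 2 * Q +
  2 * (2 * n%:R * B * (2 * n%:R * th) ^+ 2).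

Lemma density_error x : `|rho T x + resonant * cos (x 0 1)| <= inflation_error.
Proof.
set j := density_jet a D 0 0 0 T (x 0 0) (x 0 1).
have H0 := block0_le (x 0 0) (x 0 1); have H1 := block1_le (x 0 0) (x 0 1).
have H2 := block_tail_le (x 0 0) (x 0 1).
set b0 := block a D 0 _ _ _ _ _ _ in H0 H2; set b1 := block a D 1 _ _ _ _ _ _ in H1 H2.
rewrite -/j in H2.
have -> : rho T x + resonant * cos (x 0 1) = b0 + (b1 + resonant * cos (x 0 1)) + (j - b0 - b1).
  by rewrite /rho /density -/j; ring.
apply: (le_trans (ler_normD _ _)); apply: lerD => //.
by apply: (le_trans (ler_normD _ _)); apply: lerD.
Qed.

Hypothesis NT : 1 <= N%:R * T.

(** The closed form has prefactor a^2 / 8. Since N T >= 1 yields 2 d^2 T >= 1, the fast exponential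
    removes at most half of it. *)
Lemma coef2_resonant_ge d : d \in D -> a ^+ 2 / 16 * expR (- T) <= coef a [:: - d; d] T.
Proof.
move=> dD; have q0 : (d%:~R : R) != 0 by rewrite intr_eq0 D0.
rewrite coef2_resonant ?D0 ?(ltW T0) // /amplitude.
have -> : expR (- (2 * sq d + 1) * T) = expR (- T) * expR (- (2 * sq d * T)).
  by rewrite -expRD; congr expR; ring.
rewrite mulN1r.
have -> : (a * `|d%:~R| / 2) ^+ 2 / (2 * sq d) *
    (expR (- T) - expR (- T) * expR (- (2 * sq d * T))) =
  a ^+ 2 / 8 * expR (- T) * (1 - expR (- (2 * sq d * T))).
  by rewrite !exprMn real_normK ?num_real //; field.
have z1 : 1 <= 2 * sq d * T.
  have : N%:R ^+ 2 * T <= sq d * T by rewrite ler_pM2r // normd_sq.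
  have : 1 <= N%:R ^+ 2 * T.
    rewrite expr2 -mulrA; apply: (le_trans NT); rewrite ler_peMl ?ler1n //.
    by rewrite mulr_ge0 // ltW.
  by rewrite -mulrA; nra.
have : expR (- (2 * sq d * T)) <= 2^-1.
  rewrite expRN lef_pV2 ?posrE ?expR_gt0 //.
  by apply: le_trans (expR_ge1Dx _); lra.
move=> h; rewrite (_ : a ^+ 2 / 16 * _ = a ^+ 2 / 8 * expR (- T) * 2^-1); last by field.
apply: ler_wpM2l; last by lra.
by rewrite mulr_ge0 ?expR_ge0 // divr_ge0 // sqr_ge0.
Qed.

(** Each of the 2n letters d' meets -d' in the list; one such pair is kept and any other resonant
    pair contributes nonnegatively. *)
Lemma resonant_ge : 2 * n%:R * (a ^+ 2 / 16 * expR (- T)) <= resonant.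
Proof.
have -> : resonant = \sum_(d' <- D) \sum_(d <- D)
    if d + d' == 0 then coef a [:: d; d'] T else 0.
  rewrite /resonant big_mkcond /= big_allpairs_dep /= exchange_big big_map /=.
  by apply: eq_bigr => d' _; apply: eq_bigr => d _; rewrite freq2.
have -> : 2 * n%:R * (a ^+ 2 / 16 * expR (- T)) = \sum_(d <- D) a ^+ 2 / 16 * expR (- T).
  by rewrite big_const_seq count_predT iter_addr_0 -[RHS]mulr_natl Dsize.
rewrite big_seq [leRHS]big_seq; apply: ler_sum => d' dD'.
have Nd' : - d' \in D by rewrite -(perm_mem Dsym) map_f.
have pos : 0 <= a ^+ 2 / 16 * expR (- T).
  by rewrite mulr_ge0 ?expR_ge0 ?mulr_ge0 ?sqr_ge0 ?invr_ge0.
rewrite (big_rem _ Nd') /= addNr eqxx (le_trans (coef2_resonant_ge dD')) // lerDl.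
apply: sumr_ge0 => d _; case: eqP => // /eqP; rewrite addr_eq0 => /eqP ->.
exact: le_trans pos (coef2_resonant_ge dD').
Qed.

Lemma measurable_density x :
  measurable_fun [set: measurableTypeR R * measurableTypeR R * measurableTypeR R]
    (fun y => rho T (x - vec3 y)).
Proof.
apply: (measurable_fun_cvg (h := fun k (y : measurableTypeR R * measurableTypeR R * measurableTypeR R) =>
    series (fun m => block a D m 0 0 0 T (x 0 0 - y.1.1) (x 0 1 - y.1.2)) k)).
  move=> k; rewrite /series /=; apply: measurable_sum => m.
  have bE z y : block a D m 0 0 0 T z y =
      \sum_(w <- words D m) block_term m (coef a w T) (freq w)%:~R z y.
    by have [] := block_termE a D m T z y.
  under eq_fun do rewrite bE.
  apply: measurable_sum => w.
  have mx : measurable_fun [set: measurableTypeR R * measurableTypeR R * measurableTypeR R]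
      (fun y => x 0 0 - y.1.1).
    apply: measurable_funB => //.
    exact: (measurableT_comp measurable_fst measurable_fst).
  have my : measurable_fun [set: measurableTypeR R * measurableTypeR R * measurableTypeR R]
      (fun y => x 0 1 - y.1.2).
    apply: measurable_funB => //.
    exact: (measurableT_comp measurable_snd measurable_fst).
  have mcos : measurable_fun setT (@cos R).
    by apply: continuous_measurable_fun; exact: continuous_cos.
  have msin : measurable_fun setT (@sin R).
    by apply: continuous_measurable_fun; exact: continuous_sin.
  rewrite /block_term; apply: measurable_funM.
    apply: measurable_funM => //.
    apply: (measurableT_comp mcos); exact: measurable_funM.
  apply: (measurableT_comp msin); exact: measurable_funB.
move=> y _; rewrite /rho /density.
have [y0 y1 _] := vec3_coord y.
have -> : (x - vec3 y) 0 0 = x 0 0 - y.1.1 by rewrite !mxE.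
have -> : (x - vec3 y) 0 1 = x 0 1 - y.1.2 by rewrite !mxE.
by apply: density_cvg; rewrite ?(ltW T0).
Qed.

(** The density is -[resonant] cos x_2 plus an error. Heat time 1 multiplies the first part by
    exp(-1) and does not enlarge the uniform bound of the second. *)
Lemma heat_density_ge (x : 'rV[R]_3) :
  resonant * expR (-1) * cos (x 0 1) - inflation_error <= `|heat 1 (rho T) x|.
Proof.
have R0 : 0 <= resonant.
  apply: le_trans resonant_ge; rewrite !mulr_ge0 ?expR_ge0 ?sqr_ge0 ?invr_ge0 //.
pose E z := rho T z + resonant * cos (z 0 1).
have cosE (z : 'rV[R]_3) : cos (0 * z 0 0 + 0) * cos (1 * z 0 1 + 0) = cos (z 0 1).
  by rewrite mul0r !addr0 cos0 !mul1r.
have [hc hcE] := heat_mode 0 0 1 0 x (@ltr01 R).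
have [hz hzE] := heatZ resonant hc.
have zE : (fun z : 'rV[R]_3 => resonant * (cos (0 * z 0 0 + 0) * cos (1 * z 0 1 + 0))) =
    (fun z => resonant * cos (z 0 1)) by apply/funext => z; rewrite cosE.
have eE : expR (- (1 * (0 ^+ 2 + 1 ^+ 2))) = expR (-1) :> R by congr expR; ring.
rewrite hcE cosE zE eE in hzE; rewrite zE in hz.
have mrho := measurable_density x.
(* A crude bound, wanted only for the integrability that allows splitting the heat integral. *)
have rho_le z : `|rho T z| <= inflation_error + resonant.
  rewrite -[rho T z](addrK (resonant * cos (z 0 1))) (le_trans (ler_normB _ _)) //.
  apply: lerD; first exact: density_error.
  by rewrite normrM (ger0_norm R0) ler_piMr // norm_cos_le1.
have [hr _] := heat_le ltr01 mrho rho_le.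
have [hE hEE] := heatD hr hz.
have mE : measurable_fun [set: measurableTypeR R * measurableTypeR R * measurableTypeR R]
    (fun y => E (x - vec3 y)).
  apply: measurable_funD => //; apply: measurable_funM => //.
  have mcos : measurable_fun setT (@cos R).
    by apply: continuous_measurable_fun; exact: continuous_cos.
  apply: (measurableT_comp mcos).
  rewrite (_ : (fun y => _) = (fun y => x 0 1 - y.1.2)).
    apply: measurable_funB => //.
    exact: (measurableT_comp measurable_snd measurable_fst).
  by apply/funext => y; rewrite !mxE.
have [_ hle] := heat_le ltr01 mE density_error.
move: hle; rewrite hEE hzE.
set h := heat 1 (rho T) x; set c := cos (x 0 1); set e := expR _.
rewrite [e * c]mulrC mulrA => hle.
have := ler_norm (h + resonant * c * e); have := ler_norm (- h); rewrite normrN.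
lra.
Qed.

End Inflation.

(** Square z/2 <= exp(z/2). At z = N^2 T this gives N^-4, enough against the factors B and B^2 of
    the error. *)
Lemma expRN_le_sq {R : realType} (z : R) : 0 < z -> expR (- z) <= 4 / z ^+ 2.
Proof.
move=> z0; rewrite expRN -[leRHS]invrK invf_div lef_pV2 ?posrE ?expR_gt0 //; last first.
  by rewrite divr_gt0 // exprn_gt0.
have -> : z ^+ 2 / 4 = (z / 2) ^+ 2 by field.
have -> : expR z = expR (z / 2) ^+ 2 by rewrite -expRM_natl; congr expR; field.
apply: lerXn2r; rewrite ?nnegrE ?expR_ge0 ?divr_ge0 ?(ltW z0) //.
by apply: le_trans (expR_ge1Dx _); rewrite lerDr.
Qed.

(** The three terms are of order N^-3, N^-2 and N^-1; surplus powers are discarded. The bracket is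
    free of N, so N can be chosen after a, n and T. *)
Lemma inflation_error_le {R : realType} (a T : R) (N n : nat) :
  0 < a -> 0 < T -> (0 < N)%N ->
  inflation_error a N n T <= (4 * n%:R * a * 2 ^+ n / T ^+ 2 +
    4 * n%:R ^+ 2 * a ^+ 2 * 4 ^+ n / T + 2 * n%:R ^+ 3 * a ^+ 3 * 2 ^+ n) / N%:R.
Proof.
move=> a0 T0 N0; have NR : 0 < N%:R :> R by rewrite ltr0n.
have N1 : 1 <= N%:R :> R by rewrite ler1n.
have Nne : N%:R != 0 :> R by rewrite gt_eqF.
have Tne : T != 0 by rewrite gt_eqF.
have p4 : (4 : R) ^+ n = 2 ^+ n * 2 ^+ n by rewrite -exprMn; congr (_ ^+ _); ring.
have p0 : 0 <= 2 ^+ n :> R by rewrite exprn_ge0.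
have n0 : 0 <= n%:R :> R by [].
set E := expR (- (N%:R ^+ 2) * T).
have HE : E <= 4 / (N%:R ^+ 2 * T) ^+ 2.
  by rewrite /E mulNr; apply: expRN_le_sq; rewrite mulr_gt0 // exprn_gt0.
set p := 2 ^+ n in p4 p0 *; set m := n%:R in n0 *; set v := N%:R in NR N1 Nne E HE *.
have a1 := ltW a0; have T1 := ltW T0; have v1 := ltW NR.
have vi : v^-1 <= 1 by rewrite invf_le1.
have vi0 : 0 <= v^-1 by rewrite invr_ge0.
rewrite /inflation_error -/m -/v -/p -/E p4 [leRHS]mulrDl [X in _ <= X + _]mulrDl.
apply: lerD; first apply: lerD.
- apply: (@le_trans _ _ (2 * m * (a * (v * p) / 2 * (4 / (v ^+ 2 * T) ^+ 2)))).
    apply: ler_wpM2l; first by rewrite mulr_ge0.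
    by apply: ler_wpM2l => //; rewrite divr_ge0 // mulr_ge0 // mulr_ge0.
  have -> : 2 * m * (a * (v * p) / 2 * (4 / (v ^+ 2 * T) ^+ 2)) =
     4 * m * a * p / T ^+ 2 / v * (v^-1 * v^-1) by field; rewrite ?Tne ?Nne.
  rewrite ler_piMr //; last by rewrite mulr_ile1.
  by rewrite !mulr_ge0 ?invr_ge0 ?exprn_ge0.
- apply: (@le_trans _ _ ((2 * m) ^+ 2 * ((a * (v * p) / 2) ^+ 2 * (T * (4 / (v ^+ 2 * T) ^+ 2))))).
    do 3 (apply: ler_wpM2l; first by rewrite ?sqr_ge0).
    exact: HE.
  have -> : (2 * m) ^+ 2 * ((a * (v * p) / 2) ^+ 2 * (T * (4 / (v ^+ 2 * T) ^+ 2))) =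
     4 * m ^+ 2 * a ^+ 2 * (p * p) / T / v * v^-1 by field; rewrite ?Tne ?Nne.
  by rewrite ler_piMr // !mulr_ge0 ?invr_ge0 ?exprn_ge0.
- by rewrite le_eqVlt; apply/orP; left; apply/eqP; field.
Qed.

Lemma cos_gt_half {R : realType} :
  exists2 del : R, 0 < del & forall y, y \in `]- del, del[ -> 2^-1 < cos y.
Proof.
have : cos x @[x --> (0 : R)] --> (1 : R) by rewrite -cos0; exact: continuous_cos.
move=> /cvgrPdist_lt /(_ 2^-1).
rewrite invr_gt0 ltr0n => /(_ isT) [del /= del0 H].
exists del => // y; rewrite in_itv /= => yd.
have := H y; rewrite /= sub0r normrN ltr_norml => /(_ yd).
by move=> /(le_lt_trans (ler_norm _)); lra.
Qed.

Theorem theorem1p1 (R : realType) :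
  exists2 eps0 : R, 0 < eps0 &
    forall eps : R, 0 < eps < eps0 ->
      exists T : R, 0 < T < eps /\
        exists (u : R -> 'rV[R]_3 -> 'rV[R]_3) (rho : R -> 'rV[R]_3 -> R),
          [/\ boussinesq_solution T u rho,
              (besov_vec 1 (u 0%R) + besov 1 (rho 0%R) < eps%:E)%E &
              forall s : R, 0 < s -> ((eps^-1)%:E < besov s (rho T))%E].
Proof.
(* The threshold 1 ensures T <= 1, hence exp(-T) >= exp(-1). With a = eps/9 the two initial norms
   add up to at most 8 eps/9. *)
exists 1 => // eps /andP[e0 e1].
pose T := eps / 2; pose a := eps / 9.
have T0 : 0 < T by rewrite divr_gt0.
have T1 : T <= 1 by rewrite /T; lra.
have a0 : 0 < a by rewrite divr_gt0.
exists T; split; first by rewrite T0 /= /T; lra.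
have ei0 : 0 < eps^-1 by rewrite invr_gt0.
(* exp 2 pays for exp(-T) and for heat time 1, and the bound cos > 1/2 uses up the 2 of the 2n
   pairs. In eps^-1 + 2 one unit pays for the error and one for the strict inequality. *)
pose W : R := 16 * expR 2 * (eps^-1 + 2) / a ^+ 2.
have W0 : 0 <= W.
  by rewrite /W divr_ge0 ?sqr_ge0 // !mulr_ge0 ?expR_ge0 // addr_ge0 // ltW.
pose n := Num.bound W.
have nW : W < n%:R by exact: archi_boundP.
pose K : R := 4 * n%:R * a * 2 ^+ n / T ^+ 2 +
    4 * n%:R ^+ 2 * a ^+ 2 * 4 ^+ n / T + 2 * n%:R ^+ 3 * a ^+ 3 * 2 ^+ n.
have K0 : 0 <= K.
  by rewrite /K !addr_ge0 // !mulr_ge0 ?invr_ge0 ?exprn_ge0 // ltW.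
(* The summands encode the three demands on N: error at most 1, n a <= N/4, and N T >= 1. *)
pose L : R := K + 4 * n%:R * a + T^-1.
have na0 : 0 <= 4 * n%:R * a by rewrite !mulr_ge0 // ltW.
have Ti0 : 0 < T^-1 by rewrite invr_gt0.
have L0 : 0 < L by rewrite /L ltr_wpDl // addr_ge0.
pose N := Num.bound L.
have NL : L < N%:R by apply: archi_boundP; exact: ltW.
have N0 : (0 < N)%N by rewrite -(ltr0n R) (lt_trans L0).
have NR : 0 < N%:R :> R by rewrite ltr0n.
have naN : n%:R * a <= 4^-1 * N%:R by move: NL; rewrite /L -mulrA; lra.
have NT : 1 <= N%:R * T.
  rewrite -ler_pdivrMr // div1r (le_trans _ (ltW NL)) // /L.
  by rewrite lerDr addr_ge0.
have err : inflation_error a N n T <= 1.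
  apply: (le_trans (inflation_error_le n a0 T0 N0)).
  rewrite ler_pdivrMr // mul1r -/K (le_trans _ (ltW NL)) // /L -addrA lerDl.
  by rewrite addr_ge0 // ltW.
exists (velocity a (modes N n)), (density a (modes N n)); split.
- exact: inflation_solution.
- apply: (le_lt_trans (leeD (besov_velocity0 N n a0) (besov_density0 a0 N0 naN T0))).
  by rewrite -EFinD lte_fin /a; lra.
- move=> s s0; have [del del0 cosd] := @cos_gt_half R.
  apply: (@lt_le_trans _ _ (eps^-1 + 1)%:E); first by rewrite lte_fin ltrDl.
  apply: (@besov_ge _ _ _ _ [set` `]- del, del[]).
  + exact: measurable_itv.
  + by rewrite lebesgue_measure_itv /= lte_fin gtrN // -EFinB lte_fin opprK addr_gt0.
  + move=> x /= /cosd hc.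
    apply: le_trans (heat_density_ge a0 N0 naN T0 NT x).
    have hr := resonant_ge n a0 N0 T0 NT.
    have eT : expR (- 1) <= expR (- T) :> R by rewrite ler_expR lerN2.
    have q0 : 0 <= a ^+ 2 / 16 by rewrite divr_ge0 // sqr_ge0.
    set r := resonant a N n T in hr *.
    have r1 : 2 * n%:R * (a ^+ 2 / 16 * expR (- 1)) <= r.
      by apply: le_trans hr; rewrite ler_wpM2l ?mulr_ge0 // ler_wpM2l.
    have r0 : 0 <= r.
      by apply: le_trans r1; apply: mulr_ge0; [rewrite mulr_ge0 | apply: mulr_ge0 => //; exact: expR_ge0].
    have em0 : 0 < expR (- 1) :> R by exact: expR_gt0.
    have main : eps^-1 + 2 <= r * expR (- 1) * 2^-1.
      apply: (@le_trans _ _ (n%:R * (a ^+ 2 / 16 * (expR (- 1) * expR (- 1))))); last first.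
        have := ler_wpM2r (ltW em0) r1; lra.
      rewrite -expRD (_ : - 1 + - 1 = - 2 :> R); last by ring.
      have -> : n%:R * (a ^+ 2 / 16 * expR (- 2)) = n%:R / (16 * expR 2 / a ^+ 2).
        by rewrite expRN; field; rewrite !gt_eqF ?expR_gt0.
      rewrite ler_pdivlMr; last by rewrite divr_gt0 ?exprn_gt0 // mulr_gt0 ?expR_gt0.
      by apply: le_trans (ltW nW); rewrite /W le_eqVlt; apply/orP; left; apply/eqP; field; rewrite !gt_eqF.
    have : r * expR (- 1) * 2^-1 <= r * expR (- 1) * cos (x 0 1).
      by rewrite ler_wpM2l ?(ltW hc) // mulr_ge0 // ltW.
    lra.
Qed.
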